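(* Let $n\ge1$ be an integer and let $F_n=\eta_n\circ\tau^{-1}:(0,1]\to(1,+\infty)$. Then $F_n$ is a function of bounded variation, and there are functions $G_n,H_n:(0,1]\to(1,+\infty)$ such that $F_n=G_n-H_n$ and: (a) $G_n$ and $H_n$ are strictly increasing; (b) $G_n$ is continuous; (c) $H_n$ is discontinuous at every point of $\tau(\widehat{\mathcal T}^{R})$ and continuous at every point of $\tau(\widehat{\mathcal T}\setminus\widehat{\mathcal T}^{R})$; (d) the image $\mathrm{Im}(H_n)$ is bi-Lipschitz equivalent to $C_{\frac1{n+2}}\setminus C^{b}_{\frac1{n+2}}$, where $C_{\frac{1}{n+2}}$ is the $(n+2)$-th Cantor set and $C^b_{\frac1{n+2}}$ is its countable subset of points with terminating expansions. As a result, $\dim_{\mathrm H}\mathrm{Im}(H_n)=\dfrac{\log 2}{\log(n+2)}$.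
   Context: $\mathbb N$ denotes the positive integers. For integers $n,r\ge1$ and $k_1,\dots,k_r\ge 1$, with $K_i=k_1+\cdots+k_i$, define $$T_n(k_1,\dots,k_r)=\int_{[0,1]^{K_r}}\prod_{i=1}^{r}\Big[1+(x_1\cdots x_{K_i})+\cdots+(x_1\cdots x_{K_i})^n\Big]\,dx_1\cdots dx_{K_r}.$$ Let $\widehat{\mathcal T}$ be the set of all infinite sequences $(k_1,k_2,\dots)$ of positive integers, and let $\widehat{\mathcal T}^{R}$ be the subset of those for which there is $s\ge1$ with $k_s\ge2$ and $k_i=1$ for all $i>s$. Define $\eta_n:\widehat{\mathcal T}\to(1,+\infty)$ by $\eta_n((k_1,k_2,\dots))=\lim_{r\to+\infty}T_n(k_1,\dots,k_r)$ (the limit exists). The map $$\tau:\widehat{\mathcal T}\to(0,1],\qquad (k_1,k_2,\dots)\mapsto \frac1{2^{k_1}}+\frac1{2^{k_1+k_2}}+\cdots+\frac1{2^{k_1+\cdots+k_r}}+\cdots$$ is a bijection, and $\tau(\widehat{\mathcal T}^R)=\{x\in(0,1): 2^l x\in\mathbb N\text{ for some } l\in\mathbb N\}$. For $m\ge3$, the $m$-th Cantor set is $$C_{\frac1m}=\Big\{x\in[0,1]: x=\sum_{i\ge1}\frac{a_i}{m^i},\ a_i\in\{0,m-1\}\Big\},$$ and $$C^b_{\frac1m}=\Big\{x\in[0,1]: x=\frac{a_1}{m}+\cdots+\frac{a_r}{m^r}\text{ for some } r,\ a_i\in\{0,m-1\}\Big\}.$$ Two subsets $A,B\subseteq\mathbb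 R$ are bi-Lipschitz equivalent if there are a bijection $j:A\to B$ and constants $c,c'>0$ with $c|x-y|\le|j(x)-j(y)|\le c'|x-y|$ for all $x,y\in A$. $\dim_{\mathrm H}$ is Hausdorff dimension. *)

(* Defs.v *)
From HB Require Import structures.
From mathcomp Require Import all_boot all_order all_algebra.
From mathcomp Require Import all_classical all_reals all_analysis.

Set Implicit Arguments.
Unset Strict Implicit.
Unset Printing Implicit Defensive.

Import Order.TTheory GRing.Theory Num.Theory.
Import numFieldNormedType.Exports.

Local Open Scope classical_set_scope.
Local Open Scope ring_scope.

(* Lebesgue measure on R^K, as the K-fold product measure; [R^0] is a point. *)
Fixpoint lebesgue_tuple (R : realType) (K : nat) :
    set (K.-tuple (measurableTypeR R)) -> \bar R :=
  match K with
  | 0 => \d_ [tuple]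
  | K'.+1 => pushforward
      (@lebesgue_measure R \x @lebesgue_tuple R K')%E
      (fun p : measurableTypeR R * K'.-tuple (measurableTypeR R) =>
         [tuple of p.1 :: p.2])
  end.

Definition unit_cube (R : realType) (K : nat) :
    set (K.-tuple (measurableTypeR R)) :=
  [set x | forall l : 'I_K, 0 <= (tnth x l : R) <= 1].

(* [ks = [:: k_1; ...; k_r]]; the [i]-th factor (counting from 0) involves the
   first [K_(i+1) = k_1 + ... + k_(i+1)] variables. *)
Definition T_integrand (R : realType) (n : nat) (ks : seq nat)
    (x : (sumn ks).-tuple (measurableTypeR R)) : R :=
  \prod_(i < size ks) \sum_(0 <= j < n.+1)
    (\prod_(l < sumn ks | (l < sumn (take i.+1 ks))%N) (tnth x l : R)) ^+ j.

Definition T_n (R : realType) (n : nat) (ks : seq nat) : R :=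
  fine (\int[@lebesgue_tuple R (sumn ks)]_(x in unit_cube (K := sumn ks))
          (@T_integrand R n ks x)%:E)%E.

(* A sequence [(k_1, k_2, ...)] is [k : nat -> nat] with [k i] standing for
   [k_(i+1)]. *)
Definition That : set (nat -> nat) := [set k | forall i, (0 < k i)%N].

Definition ThatR : set (nat -> nat) :=
  [set k | That k /\
     exists s, (2 <= k s)%N /\ forall i, (s < i)%N -> k i = 1%N].

Definition eta_n (R : realType) (n : nat) (k : nat -> nat) : R :=
  limn (fun r => T_n R n (mkseq k r)).

Definition tau (R : realType) (k : nat -> nat) : R :=
  limn (series (fun r => (2 ^- (\sum_(0 <= i < r.+1) k i)%N) : R)).

(* [pinv That tau] is the inverse of [tau : That -> (0, 1]]; values of [F_n]
   outside [(0, 1]] are irrelevant. *)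
Definition F_n (R : realType) (n : nat) : R -> R :=
  eta_n R n \o pinv That (@tau R).

(* The library's [bounded_variation] is for closed bounded intervals only. *)
Definition bounded_variation_on (R : realType) (A : set R) (f : R -> R) : Prop :=
  exists M : R, forall (a : R) (s : seq R),
    path <%R a s -> (forall x, x \in a :: s -> A x) ->
    variation a (last a s) f s <= M.

Definition cantor_set (R : realType) (m : nat) : set R :=
  [set x : R | 0 <= x <= 1 /\ exists a : nat -> nat,
     (forall i, a i = 0%N \/ a i = m.-1) /\
     series (fun i => (a i)%:R / m%:R ^+ i.+1 : R) @ \oo --> x].

Definition cantor_set_b (R : realType) (m : nat) : set R :=
  [set x : R | 0 <= x <= 1 /\ exists (r : nat) (a : nat -> nat),
     (forall i, a i = 0%N \/ a i = m.-1) /\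
     x = \sum_(0 <= i < r) (a i)%:R / m%:R ^+ i.+1].

Definition bilipschitz_equiv (R : realType) (A B : set R) : Prop :=
  exists j : R -> R, set_bij A B j /\
    exists c c' : R, [/\ 0 < c, 0 < c' &
      forall x y, A x -> A y ->
        c * `|x - y| <= `|j x - j y| <= c' * `|x - y|].

(* Equal to [-oo] on the empty set. *)
Definition diameter (R : realType) (U : set R) : \bar R :=
  ereal_sup [set `|x - y|%:E | x in U & y in U].

(* [diam U ^ s], with the empty set contributing [0] also when [s = 0]. *)
Definition hausdorff_gauge (R : realType) (s : R) (U : set R) : \bar R :=
  if U == set0 then 0%E else poweR (diameter U) s.

Definition hausdorff_pre (R : realType) (s delta : R) (A : set R) : \bar R :=
  ereal_inf [set (\sum_(0 <= i <oo) hausdorff_gauge s (U i))%E |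
    U in [set U : nat -> set R | A `<=` \bigcup_i U i /\
                                 forall i, (diameter (U i) <= delta%:E)%E]].

Definition hausdorff_measure (R : realType) (s : R) (A : set R) : \bar R :=
  ereal_sup [set hausdorff_pre s delta A | delta in [set d : R | 0 < d]].

Definition hausdorff_dim (R : realType) (A : set R) : \bar R :=
  ereal_inf [set s%:E | s in [set s : R | 0 <= s /\ hausdorff_measure s A = 0%E]].

(* Main.v *)
(** Reading the integral [T_n] one variable at a time, each variable applies either
    the averaging operator [A_0 f (p) = \int_0^1 f (p t) dt] or
    [A_1 f = A_0 ((1 + X + ... + X^n) f)], according to the binary digits of
    [x = tau k]; hence [F_n x = (A_(b_1) A_(b_2) ... 1)(1)], where [b_1 b_2 ...] is the
    binary expansion of [x] with infinitely many ones. Both operators are positive,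
    and [g = exp (X + X^2/2 + ... + X^n/n)] satisfies [A_1 g = g] and [A_0 g <= g].
    On the dyadic interval with digit word [w] the function [F_n] therefore takes its
    values in [[A_w 1 (1), A_w g (1)]], and at the dyadic point separating the
    intervals [w0] and [w1] it jumps down by
    [jump w = A_w (A_0 g - A_1 1)(1) = A_w A_0 (g - 1 - X - ... - X^n)(1)].
    Since [g - 1 - X - ... - X^n] is of exact order [X^(n+1)] and [X^a g^(a+1)] is an
    eigenvector of [A_1] for the eigenvalue [1/(a+1)], this jump is comparable to
    [(n+2)^(-|w|)]. Now [H] is the sum of the jumps to the left of [x], and
    [G = F_n + H]. For [x < y] whose expansions separate after the word [w],
    [H y - H x] is comparable to [(n+2)^(-|w|)], just as for the points of the Cantor
    set with the same digits, while [|x - y| <= 2^(-|w|)]; this gives the bi-Lipschitz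
    equivalence and, comparing covers of the image with Lebesgue measure on [(0,1]],
    the Hausdorff dimension. *)
Require Import Defs.
From HB Require Import structures.
From mathcomp Require Import all_boot all_order all_algebra.
From mathcomp Require Import all_classical all_reals all_analysis.
From mathcomp Require Import measurable_realfun.
From mathcomp Require Import ring lra zify.

Set Implicit Arguments.
Unset Strict Implicit.
Unset Printing Implicit Defensive.

Import Order.TTheory GRing.Theory Num.Theory.
Import numFieldNormedType.Exports.

Local Open Scope classical_set_scope.
Local Open Scope ring_scope.

(** * Integration over the unit cube *)

Lemma product_measure1_sigma_finite d1 d2 (T1 : measurableType d1)
    (T2 : measurableType d2) (R : realType)
    (m1 : {sigma_finite_measure set T1 -> \bar R})
    (m2 : {sigma_finite_measure set T2 -> \bar R}) :
  sigma_finite setT (m1 \x m2)%E.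
Proof.
have /sigma_finiteP[F [TF ndF Foo]] := sigma_finiteT m1.
have /sigma_finiteP[G [TG ndG Goo]] := sigma_finiteT m2.
exists (fun n => F n `*` G n).
  rewrite -setXTT TF TG predeqE => -[x y]; split; last first.
    by move=> [n _ []/= ? ?]; split; exists n.
  move=> [/= [n _ Fnx] [k _ Gky]]; exists (maxn n k) => //; split.
    by move: x Fnx; exact/subsetPset/ndF/leq_maxl.
  by move: y Gky; exact/subsetPset/ndG/leq_maxr.
move=> k; have [? ?] := Foo k; have [? ?] := Goo k.
split; first exact: measurableX.
by rewrite product_measure1E// lte_mul_pinfty// ge0_fin_numE.
Qed.

(** Tonelli needs a sigma-finite measure, while [lebesgue_tuple] is a bare set function. In the
    induction, sigma-finiteness passes through the consing map by its measurable left inverse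
    [psi]. *)
Lemma lebesgue_tuple_measure (R : realType) (K : nat) :
  exists mu : {sigma_finite_measure set (K.-tuple (measurableTypeR R)) -> \bar R},
    @lebesgue_tuple R K = mu.
Proof.
elim: K => [|K [mu lmu]].
  by exists \d_([tuple] : 0.-tuple (measurableTypeR R)).
pose phi (p : measurableTypeR R * K.-tuple (measurableTypeR R)) :
  K.+1.-tuple (measurableTypeR R) := [tuple of p.1 :: p.2].
have mphi : measurable_fun setT phi by exact: measurable_cons.
pose pm := (@product_measure1 _ _ (measurableTypeR R) _ R lebesgue_measure mu :
  {measure set (measurableTypeR R * K.-tuple (measurableTypeR R))%type -> \bar R}).
pose nu := measure_function_pushforward__canonical__measure_function_Measure pm mphi.
have sf : sigma_finite setT nu.
  have [F FT Ffin] := @product_measure1_sigma_finite _ _ (measurableTypeR R) _ R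
    lebesgue_measure mu.
  pose psi (t : K.+1.-tuple (measurableTypeR R)) := (thead t, [tuple of behead t]).
  have mpsi : measurable_fun setT psi.
    apply/measurable_fun_pair; last exact: measurable_behead.
    exact: measurable_tnth.
  have phiK : psi \o phi = id.
    apply/funext => -[a t]; rewrite /psi /phi/= theadE; congr pair.
    exact: val_inj.
  exists (fun i => psi @^-1` F i).
    by rewrite -preimage_bigcup -FT preimage_setT.
  move=> i; have [mF Fi] := Ffin i; split.
    by rewrite -[X in measurable X]setTI; exact: mpsi.
  by rewrite /= /pushforward -comp_preimage phiK.
pose nuS : {sigma_finite_measure set (K.+1.-tuple (measurableTypeR R)) -> \bar R} :=
  HB.pack (nu : set _ -> \bar R) (Measure.class nu)
    (Measure_isSigmaFinite.Build _ _ _ nu sf).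
by exists nuS; rewrite /= lmu.
Qed.

Lemma measurable_unit_cube (R : realType) (K : nat) : measurable (@unit_cube R K).
Proof.
rewrite (_ : @unit_cube R K = \bigcap_(l in [set: 'I_K])
   ((@tnth K (measurableTypeR R))^~ l @^-1` `[0, 1]%classic)).
  apply: fin_bigcap_measurable => // l _.
  rewrite -[X in measurable X]setTI; exact: measurable_tnth.
apply/seteqP; split => x /= h l; last by move: (h l I); rewrite /= in_itv.
by move=> _; rewrite /= in_itv /=; exact: h.
Qed.

Lemma integral_unit_cubeS (R : realType) (K : nat)
    (f : K.+1.-tuple (measurableTypeR R) -> \bar R) :
  measurable_fun [set: K.+1.-tuple (measurableTypeR R)] f ->
  (forall x, unit_cube x -> 0 <= f x)%E ->
  (\int[@lebesgue_tuple R K.+1]_(x in @unit_cube R K.+1) f x =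
   \int[lebesgue_measure]_(t in `[0%R, 1%R])
     \int[@lebesgue_tuple R K]_(x in @unit_cube R K) f [tuple of t :: x])%E.
Proof.
move=> mf f0.
have [mu lmu] := lebesgue_tuple_measure R K.
pose phi (p : measurableTypeR R * K.-tuple (measurableTypeR R)) :
  K.+1.-tuple (measurableTypeR R) := [tuple of p.1 :: p.2].
have mphi : measurable_fun setT phi by exact: measurable_cons.
have mC := @measurable_unit_cube R K.+1.
have cubeE (t : measurableTypeR R) (x : K.-tuple (measurableTypeR R)) :
    @unit_cube R K.+1 [tuple of t :: x] <->
    `[0, 1]%classic (t : R) /\ unit_cube x.
  split=> [h|[/= + h] l]; rewrite ?in_itv/=.
    split=> [|l]; first exact: (h ord0).
    by have := h (lift ord0 l); rewrite tnthS.
  case: (unliftP ord0 l) => [j ->|->]; last by rewrite tnth0.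
  by rewrite tnthS.
rewrite /= lmu.
rewrite (@ge0_integral_pushforward _ _ _ _ _ _ mphi
  (@product_measure1 _ _ (measurableTypeR R) _ R lebesgue_measure mu))//; first last.
- by move=> x; rewrite inE; exact: f0.
- exact: measurable_funTS.
rewrite integral_mkcond.
set g := (X in (\int[_]_x X x)%E).
have mg : measurable_fun setT g.
  apply/(measurable_restrictT _ _).1.
    by rewrite -[X in measurable X]setTI; exact: mphi.
  by apply: measurable_funTS; exact: measurableT_comp.
have g0 z : (0 <= g z)%E.
  by rewrite /g patchE; case: ifPn => //; rewrite inE; exact: f0.
transitivity (\int[@lebesgue_measure R]_t fubini_F mu g t)%E.
  exact: (@fubini_tonelli1 _ _ (measurableTypeR R) _ R lebesgue_measure mu g mg g0).
rewrite [RHS]integral_mkcond; apply: eq_integral => t _.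
rewrite /fubini_F /g patchE; case: ifPn => [|].
  rewrite inE /= => t01; rewrite [RHS]integral_mkcond; apply: eq_integral => x _.
  rewrite !patchE; congr (if _ then _ else _).
  by apply/idP/idP; rewrite !inE => h; [case/cubeE: h|apply/cubeE].
move=> /negP; rewrite inE => t01; rewrite integral0_eq// => x _.
by rewrite patchE; case: ifPn => //; rewrite inE /phi/= => /cubeE[].
Qed.

(** * The averaging operator on polynomials *)

Section averaging.
Variable R : realType.
Implicit Types (p q : {poly R}).

(** The operator [A_0] on polynomials: averaging [(p t)^i] over [t] in [[0, 1]] gives
    [p^i / (i + 1)]. *)
Definition mean_poly q : {poly R} := \poly_(i < size q) (q`_i / i.+1%:R).

Lemma coef_mean_poly q i : (mean_poly q)`_i = q`_i / i.+1%:R.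
Proof.
by rewrite coef_poly; case: ltnP => // h; rewrite nth_default// mul0r.
Qed.

Lemma deriv_mean_polyX q : (mean_poly q * 'X)^`() = q.
Proof.
apply/polyP => i; rewrite coef_deriv coefMX/= coef_mean_poly -[LHS]mulr_natr.
by rewrite mulfVK ?pnatr_eq0.
Qed.

Lemma mean_poly_comp q (c : R) : mean_poly (q \Po (c *: 'X)) = mean_poly q \Po (c *: 'X).
Proof.
have coefZ_comp r i : (r \Po (c *: 'X))`_i = r`_i * c ^+ i.
  rewrite comp_polyE coef_sum; under eq_bigr do rewrite exprZn !coefZ coefXn.
  have [ir|ir] := ltnP i (size r); last first.
    rewrite nth_default// mul0r big1// => j _; case: eqP => [ij|]; last by rewrite !mulr0.
    by have := ltn_ord j; rewrite -ij ltnNge ir.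
  rewrite (bigD1 (Ordinal ir))//= eqxx mulr1 big1 ?addr0// => j.
  by rewrite -val_eqE/= eq_sym => /negbTE ->; rewrite !mulr0.
by apply/polyP => i; rewrite coef_mean_poly !coefZ_comp coef_mean_poly mulrAC.
Qed.

Lemma integral01_poly q :
  (\int[lebesgue_measure]_(t in `[0%R, 1%R]) (q.[t])%:E = ((mean_poly q).[1])%:E)%E.
Proof.
have /funext Dq t : q.[t] = (horner (mean_poly q * 'X))^`()%classic t.
  by rewrite -derivE deriv_mean_polyX.
rewrite (@continuous_FTC2 _ (horner q) (horner (mean_poly q * 'X)))//.
- by rewrite !hornerMX mulr1 mulr0 sube0.
- by apply: continuous_subspaceT => x; exact: continuous_horner.
- split=> [x _| |]; first exact: derivable_horner.
    by exact/cvg_at_right_filter/continuous_horner.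
  by exact/cvg_at_left_filter/continuous_horner.
- by move=> x _; rewrite -derivE deriv_mean_polyX.
Qed.

Lemma integral01_poly_scale q (c : R) :
  (\int[lebesgue_measure]_(t in `[0%R, 1%R]) (q.[c * t])%:E =
   ((mean_poly q).[c])%:E)%E.
Proof.
under eq_integral => t _.
  have -> : q.[c * t] = (q \Po (c *: 'X)).[t] by rewrite horner_comp hornerZ hornerX.
  over.
by rewrite integral01_poly mean_poly_comp horner_comp hornerZ hornerX mulr1.
Qed.

End averaging.

(** * Cube integrals as iterated averages along binary words *)

Section word_integrals.
Variables (R : realType) (n : nat).
Implicit Types (w : seq bool) (s : seq R) (p : R).

Definition geometric_sum (x : R) : R := \sum_(0 <= j < n.+1) x ^+ j.

Definition take_prod m s : R := \prod_(t <- take m s) t.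

Lemma take_prodD m m' s :
  take_prod (m + m') s = take_prod m s * take_prod m' (drop m s).
Proof. by rewrite /take_prod takeD big_cat. Qed.

Definition digit_factor (b : bool) (x : R) : R := if b then geometric_sum x else 1.

(** [p] holds the product of the variables already read, so that the recursion of
    [word_integrand_cons] stays inside the family. *)
Definition word_integrand p w s : R :=
  \prod_(i < size w) digit_factor (nth false w i) (p * take_prod i.+1 s).

Lemma word_integrand_cons p b w s :
  word_integrand p (b :: w) s =
  digit_factor b (p * take_prod 1 s) * word_integrand (p * take_prod 1 s) w (drop 1 s).
Proof.
rewrite /word_integrand /= big_ord_recl /=; congr (_ * _); apply: eq_bigr => i _.
by rewrite -mulrA -take_prodD add1n.
Qed.

Lemma digit_factor_ge0 b x : 0 <= x -> 0 <= digit_factor b x.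
Proof.
by case: b => //= x0; apply: sumr_ge0 => j _; exact: exprn_ge0.
Qed.

Lemma take_prod_tuple K (x : K.-tuple R) m :
  take_prod m x = \prod_(l < K | (l < m)%N) tnth x l.
Proof.
rewrite /take_prod; have [Km|mK] := leqP K m.
  rewrite take_oversize ?size_tuple// big_tuple; apply: eq_bigl => l.
  by rewrite (leq_trans (ltn_ord l)).
rewrite (big_nth 0) size_take size_tuple mK (big_nat_widen _ _ K)//=; last exact: ltnW.
rewrite big_mkord; apply: eq_big => // l lm; rewrite nth_take//.
by rewrite (tnth_nth 0).
Qed.

Definition mean_word w : {poly R} := foldr (fun b q =>
  mean_poly (if b then (\sum_(0 <= j < n.+1) 'X^j) * q else q)) 1 w.

Lemma measurable_word_integrand K p w :
  measurable_fun setT (fun x : K.-tuple (measurableTypeR R) => word_integrand p w x).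
Proof.
apply: measurable_prod => i _; rewrite /digit_factor; case: nth => //.
apply: measurable_sum => j; apply: measurable_funX; apply: measurable_funM => //.
under eq_fun do rewrite take_prod_tuple big_mkcond; apply: measurable_prod => l _.
case: (l < i.+1)%N => //; exact: measurable_tnth.
Qed.

Lemma word_integrand_ge0 K p w (x : K.-tuple R) :
  0 <= p -> unit_cube x -> 0 <= word_integrand p w x.
Proof.
move=> p0 x01; apply: prodr_ge0 => i _; apply/digit_factor_ge0/mulr_ge0 => //.
by rewrite take_prod_tuple; apply: prodr_ge0 => l _; have /andP[] := x01 l.
Qed.

(** Induction with [p] free: once the first variable [t] is split off, the inner integral is the
    induction hypothesis at [p * t], and the integral over [t] is one application of [mean_poly]. *)
Lemma integral_word_integrand K p w : size w = K -> 0 <= p ->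
  (\int[@lebesgue_tuple R K]_(x in @unit_cube R K) (word_integrand p w x)%:E =
   ((mean_word w).[p])%:E)%E.
Proof.
elim: w K p => [|b w IH] [|K] //= p.
  move=> _ _; rewrite /word_integrand; under eq_integral do rewrite big_ord0.
  rewrite integral_cst//=; last exact: measurable_unit_cube.
  rewrite diracE mem_set ?mul1e ?hornerC// => -[[]//].
move=> [wK] p0; rewrite integral_unit_cubeS; first last.
- by move=> x x01; rewrite lee_fin; exact: word_integrand_ge0.
- by apply/measurable_EFinP; exact: measurable_word_integrand.
have [mu lmu] := lebesgue_tuple_measure R K.
rewrite -integral01_poly_scale; apply: eq_integral => t.
rewrite inE /= in_itv /= => /andP[t0 t1].
rewrite lmu; under eq_integral => x _.
  rewrite word_integrand_cons /take_prod /= take0 big_seq1 drop0 EFinM; over.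
rewrite ge0_integralZl//; first last.
- by rewrite lee_fin; apply/digit_factor_ge0/mulr_ge0.
- by move=> x x01; rewrite lee_fin word_integrand_ge0// mulr_ge0.
- by apply/measurable_EFinP/measurable_funTS; exact: measurable_word_integrand.
- exact: measurable_unit_cube.
have := IH K (p * t) wK (mulr_ge0 p0 t0); rewrite lmu => ->; rewrite -EFinM.
congr EFin; case: b => /=; last by rewrite mul1r.
rewrite hornerM; congr (_ * _); rewrite horner_sum; apply: eq_bigr => j _.
by rewrite hornerXn.
Qed.

(** The binary digits that [k] contributes to [tau]. A zero stands for a variable that closes no
    factor of the integrand, a one for a variable that closes one. *)
Definition block (k : nat) : seq bool := rcons (nseq k.-1 false) true.
Definition word (ks : seq nat) : seq bool := flatten (map block ks).

Lemma size_word ks : all (leq 1) ks -> size (word ks) = sumn ks.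
Proof.
elim: ks => //= k ks IH /andP[k0 /IH h].
by rewrite size_cat h size_rcons size_nseq prednK.
Qed.

Lemma word_integrand_block p k w s : (0 < k)%N ->
  word_integrand p (block k ++ w) s =
  geometric_sum (p * take_prod k s) * word_integrand (p * take_prod k s) w (drop k s).
Proof.
case: k => // k _; elim: k p s => [|k IH] p s; first exact: word_integrand_cons.
rewrite [LHS]word_integrand_cons /digit_factor mul1r -/(block k.+1) IH.
by rewrite -mulrA -take_prodD add1n drop_drop addn1.
Qed.

Lemma word_integrand_word p ks s : all (leq 1) ks ->
  word_integrand p (word ks) s =
  \prod_(i < size ks) geometric_sum (p * take_prod (sumn (take i.+1 ks)) s).
Proof.
elim: ks p s => [|k ks IH] p s /= => [_|/andP[k0 ks0]].
  by rewrite /word_integrand !big_ord0.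
rewrite word_integrand_block// IH// big_ord_recl/= take0/= addn0; congr (_ * _).
by apply: eq_bigr => i _; rewrite -mulrA -take_prodD.
Qed.

Lemma T_nE ks : all (leq 1) ks -> T_n R n ks = (mean_word (word ks)).[1].
Proof.
move=> ks0; rewrite /T_n.
have [mu lmu] := lebesgue_tuple_measure R (sumn ks); rewrite lmu.
under eq_integral => x _.
  rewrite (_ : T_integrand n x = word_integrand 1 (word ks) x); last first.
    rewrite word_integrand_word// /T_integrand; apply: eq_bigr => i _.
    by apply: eq_bigr => j _; rewrite mul1r take_prod_tuple.
  over.
have := integral_word_integrand (size_word ks0) ler01.
by rewrite lmu => ->.
Qed.

End word_integrals.

(** * Values of iterated averaging operators *)

Section moments.
Variables (R : realType) (n : nat).
Implicit Types (w : seq bool) (a i j l N : nat).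

(* Words are stored with their last digit first. [moment w j] is the value at [1]
   of the operators of [mean_word] applied along [w] to the monomial [X^j]. *)
Fixpoint moment w j : R :=
  if w is b :: w' then
    \sum_(0 <= l < if b then n.+1 else 1%N) moment w' (l + j) / (l + j).+1%:R
  else 1.

Lemma moment_false w j : moment (false :: w) j = moment w j / j.+1%:R.
Proof. by rewrite /= big_nat1. Qed.

Lemma moment_true w j : moment (true :: w) j =
  \sum_(0 <= l < n.+1) moment w (l + j) / (l + j).+1%:R.
Proof. by []. Qed.

Lemma moment_ge0 w j : 0 <= moment w j.
Proof.
elim: w j => //= b w IH j; apply: sumr_ge0 => l _.
by rewrite divr_ge0.
Qed.

Lemma moment_antitone w : {homo moment w : i j / (i <= j)%N >-> j <= i}.
Proof.
elim: w => //= b w IH i j ij; apply: ler_sum => l _.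
have lij : (l + i <= l + j)%N by rewrite leq_add2l.
by rewrite ler_pM ?moment_ge0 ?invr_ge0 ?IH// lef_pV2 ?posrE// ler_nat ltnS.
Qed.

Lemma moment_false0 w : moment (false :: w) 0 = moment w 0.
Proof. by rewrite moment_false divr1. Qed.

Lemma moment_true0 w : moment w 0 <= moment (true :: w) 0.
Proof.
rewrite moment_true big_nat_recl// add0n divr1 lerDl; apply: sumr_ge0 => l _.
by rewrite divr_ge0// moment_ge0.
Qed.

(** At every letter only the summand [l = 0] is kept, which divides by [j + 1]. *)
Lemma moment_lower w j : (j.+1%:R ^+ size w)^-1 <= moment w j.
Proof.
elim: w => [|b w IH]; first by rewrite invr1.
have j0 : 0 <= j.+1%:R^-1 :> R by rewrite invr_ge0.
rewrite [size _]/= exprS invfM mulrC (le_trans (ler_wpM2r j0 IH))//.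
rewrite /=; case: b; rewrite big_nat_recl// add0n lerDl; apply: sumr_ge0 => l _;
  by rewrite divr_ge0// moment_ge0.
Qed.

Lemma convolution_sum (q f : nat -> R) N :
  \sum_(0 <= i < N) q i * (\sum_(0 <= l < n.+1) f (l + i)%N) =
  \sum_(0 <= t < N + n)
    (\sum_(0 <= l < n.+1) if (l <= t < N + l)%N then q (t - l)%N else 0) * f t.
Proof.
under eq_bigr do rewrite big_distrr/=.
under [RHS]eq_bigr do rewrite big_distrl/=.
rewrite exchange_big [RHS]exchange_big/= !big_mkord.
apply: eq_bigr => -[l ln] _ /=; rewrite ltnS in ln.
rewrite [RHS](big_cat_nat (n := l))//=; last by rewrite (leq_trans ln)// leq_addl.
rewrite [X in _ = X + _]big_nat [X in _ = X + _]big1 ?add0r; last first.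
  by move=> t /andP[_ tl]; rewrite leqNgt tl/= mul0r.
rewrite -{2}(add0n l) big_addn -addnBA// [RHS](big_cat_nat (n := N))//= ?leq_addr//.
rewrite [X in _ = _ + X]big_nat [X in _ = _ + X]big1 ?addr0; last first.
  by move=> t /andP[Nt _]; rewrite ltn_add2r ltnNge Nt andbF mul0r.
apply: eq_big_nat => t /andP[_ tN].
by rewrite leq_addl ltn_add2r tN addnK addnC.
Qed.

(** Letters pass one at a time from the polynomial, where they act on coefficients, to [moment],
    where they act by the transposed operator. With [v] empty this yields [T_n] as a moment. *)
Lemma mean_word_moment w v :
  (mean_word R n (rev w ++ v)).[1] =
  \sum_(0 <= i < size (mean_word R n v)) (mean_word R n v)`_i * moment w i.
Proof.
elim: w v => [|b w IH] v.
  rewrite horner_coef big_mkord; apply: eq_bigr => i _.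
  by rewrite expr1n.
rewrite rev_cons cat_rcons IH; set q := mean_word R n v.
have big_widen (p : {poly R}) f N : (size p <= N)%N ->
    \sum_(0 <= i < size p) p`_i * f i = \sum_(0 <= i < N) p`_i * f i.
  move=> pN; rewrite [RHS](big_cat_nat (n := size p))//=.
  rewrite [X in _ = _ + X]big_nat [X in _ = _ + X]big1 ?addr0// => i /andP[pi _].
  by rewrite nth_default ?mul0r.
pose S : {poly R} := \sum_(0 <= j < n.+1) 'X^j.
rewrite (big_widen (mean_word R n (b :: v)) _ (size q + n)%N); last first.
  rewrite /= (leq_trans (size_poly _ _))//; case: b; last exact: leq_addr.
  have sS : (size S <= n.+1)%N.
    rewrite /S big_mkord; apply: (leq_trans (size_sum _ _ _)).
    by apply/bigmax_leqP => j _; rewrite size_polyXn.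
  apply: (leq_trans (size_polyMleq S q)).
  by move: (size S) (size q) sS => x y; lia.
under eq_bigr do rewrite /= coef_mean_poly -mulrA (mulrC _^-1).
case: b => /=; last first.
  rewrite -(big_widen q) ?leq_addr//; apply: eq_bigr => i _.
  by rewrite big_nat1.
rewrite (convolution_sum (fun i => q`_i) (fun t => moment w t / t.+1%:R)).
apply: eq_big_nat => t /andP[_ tqn]; congr (_ * _).
rewrite big_distrl/= coef_sum; apply: eq_bigr => l _.
rewrite coefXnM ltnNge; case: leqP => //= lt; case: ltnP => // h.
by rewrite nth_default// leq_subRL// addnC.
Qed.

Lemma T_n_moment ks : all (leq 1) ks ->
  T_n R n ks = moment (rev (word ks)) 0.
Proof.
move=> ks0; rewrite T_nE// -[word ks in LHS]revK -[rev (rev _)]cats0 mean_word_moment.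
by rewrite /= size_poly1 big_nat1 coef1/= mul1r.
Qed.

End moments.

(** * Power series of the powers of [g] and eigenvector bounds for moments *)

Section exp_coefficients.
Variables (R : realType) (n : nat).
Implicit Types (w : seq bool) (a i j l N : nat).

(* [exp_coef a] are the power series coefficients of [g ^ a.+1], where
   [g(X) = exp (X + X^2/2 + ... + X^n/n)]: the differential equation
   [X g' = (X + ... + X^n) g] turns into the recurrence [exp_coefS]. The list
   holds the coefficients [i, i - 1, ..., 0]. *)
Fixpoint exp_coefs a i : seq R :=
  if i is i'.+1 then
    (a.+1%:R / i%:R * \sum_(0 <= l < n) (exp_coefs a i')`_l) :: exp_coefs a i'
  else [:: 1].

Definition exp_coef a i : R := head 0 (exp_coefs a i).

Lemma nth_exp_coefs a i l :
  (exp_coefs a i)`_l = if (l <= i)%N then exp_coef a (i - l) else 0.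
Proof.
elim: i l => [|i IH] [|l] //=; by rewrite nth_nil.
Qed.

Lemma exp_coef0 a : exp_coef a 0 = 1. Proof. by []. Qed.

Lemma exp_coefS a i : exp_coef a i.+1 =
  a.+1%:R / i.+1%:R *
  \sum_(0 <= l < n) if (l <= i)%N then exp_coef a (i - l) else 0.
Proof.
by congr (_ * _); apply: eq_bigr => l _; rewrite nth_exp_coefs.
Qed.

Lemma exp_coef_ge0 a i : 0 <= exp_coef a i.
Proof.
elim/ltn_ind: i => -[|i] IH; first by rewrite exp_coef0.
rewrite exp_coefS mulr_ge0// sumr_ge0// => l _.
by case: ifP => // _; apply: IH; rewrite ltnS leq_subr.
Qed.

(** Coefficient form of [A_1 (X^a g^(a+1)) = X^a g^(a+1) / (a+1)]: the left side is the coefficient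
    of [X^(a+t)] in [(1 + ... + X^n) X^a g^(a+1)], which [A_1] divides by [a + t + 1]. *)
Lemma exp_coef_window a t :
  \sum_(0 <= l < n.+1) (if (l <= t)%N then exp_coef a (t - l) else 0) =
  exp_coef a t * (a + t).+1%:R / a.+1%:R.
Proof.
rewrite big_nat_recl//= subn0; case: t => [|t].
  by rewrite exp_coef0 addn0 mul1r divff ?pnatr_eq0// big1 ?addr0.
have -> : \sum_(0 <= i < n) (if (i < t.+1)%N then exp_coef a (t.+1 - i.+1) else 0) =
    exp_coef a t.+1 * t.+1%:R / a.+1%:R.
  have cancel (x y z : R) : y != 0 -> z != 0 -> x = z / y * x * y / z.
    by move=> y0 z0; field; rewrite ?y0 ?z0.
  by rewrite exp_coefS; apply: cancel; rewrite pnatr_eq0.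
have a0 : a.+1%:R != 0 :> R by rewrite pnatr_eq0.
rewrite -addSn natrD mulrDr mulrDl; congr (_ + _).
by rewrite -mulrA divff ?mulr1.
Qed.

Lemma exp_coef_geometric a : exists2 C : R, 0 <= C & forall i, exp_coef a i <= C / 2 ^+ i.
Proof.
(* Beyond [I0] the factor [a.+1 / i] of the recurrence outweighs its [n] terms, each at most [2 ^ n]
   times the target bound; [C] absorbs the coefficients up to [I0]. *)
pose I0 := (a.+1 * n * 2 ^ n)%N.
pose C : R := \sum_(0 <= i < I0.+1) exp_coef a i * 2 ^+ i.
have C0 : 0 <= C.
  by apply: sumr_ge0 => i _; rewrite mulr_ge0// exp_coef_ge0.
exists C => //; elim/ltn_ind => i IH.
rewrite ler_pdivlMr ?exprn_gt0//.
have [iI|] := leqP i I0.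
  rewrite /C big_mkord (bigD1 (Ordinal (iI : i < I0.+1)%N))//= lerDl.
  by apply: sumr_ge0 => k _; rewrite mulr_ge0// exp_coef_ge0.
case: i IH => // i IH Ii.
have h : \sum_(0 <= l < n) (if (l <= i)%N then exp_coef a (i - l) else 0) <=
    \sum_(0 <= l < n) C * 2 ^+ n / 2 ^+ i.+1.
  rewrite big_nat [leRHS]big_nat; apply: ler_sum => l /andP[_ ln].
  case: ifP => li; last by rewrite divr_ge0 ?mulr_ge0.
  rewrite (le_trans (IH _ _)) ?ltnS ?leq_subr// -mulrA ler_wpM2l//.
  rewrite ler_pdivlMr ?exprn_gt0// mulrC ler_pdivrMr ?exprn_gt0//.
  by rewrite -exprD ler_weXn2l ?ler1n//; lia.
rewrite exp_coefS -[_ / i.+1%:R * _]mulrAC -[_ / i.+1%:R * _]mulrAC.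
rewrite ler_pdivrMr ?ltr0Sn//.
apply: (@le_trans _ _ (a.+1%:R * (\sum_(0 <= l < n) C * 2 ^+ n / 2 ^+ i.+1) * 2 ^+ i.+1)).
  by rewrite ler_wpM2r// ler_wpM2l.
rewrite sumr_const_nat subn0 -[_ *+ n]mulr_natr.
have -> : a.+1%:R * (C * 2 ^+ n / 2 ^+ i.+1 * n%:R) * 2 ^+ i.+1 =
   C * (I0%:R : R).
  have h2 : 2 ^+ i.+1 != 0 :> R by rewrite expf_neq0.
  rewrite /I0 !natrM natrX.
  move: (a.+1%:R : R) (2 ^+ i.+1 : R) h2 => x y y0; field.
  exact: y0.
by rewrite ler_wpM2l// ler_nat ltnW.
Qed.

Lemma exp_coef_summable a :
  exists2 C : R, 0 < C & forall N, \sum_(0 <= i < N) exp_coef a i <= C.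
Proof.
have [C C0 hC] := exp_coef_geometric a.
exists (2 * C + 1) => [|N]; first by rewrite ltr_wpDl ?mulr_ge0.
apply: (@le_trans _ _ (C * (2 - 2 / 2 ^+ N))); last first.
  have : 0 <= C * (2 / 2 ^+ N) by rewrite mulr_ge0// divr_ge0.
  by rewrite mulrBr mulrC; lra.
elim: N => [|N IH]; first by rewrite big_nil expr0 divr1 subrr mulr0.
rewrite big_nat_recr//= (le_trans (lerD IH (hC N)))// exprS.
have h2 : 2 ^+ N != 0 :> R by rewrite expf_neq0.
rewrite le_eqVlt; apply/orP; left; apply/eqP.
by move: (2 ^+ N : R) h2 => x x0; field; exact: x0.
Qed.

(** Up to order [n] the exponent of [g] agrees with [- log (1 - X)], so [g] agrees with
    [1 / (1 - X)]; in the recurrence each such coefficient is the mean of all preceding ones. *)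
Lemma exp_coef0_eq1 i : (i <= n)%N -> exp_coef 0 i = 1.
Proof.
elim/ltn_ind: i => -[|i] IH ltin; first by rewrite exp_coef0.
rewrite exp_coefS (big_cat_nat (n := i.+1))//=.
rewrite [X in _ + X]big_nat [X in _ + X]big1 ?addr0 => [|l /andP[il _]]; last first.
  by rewrite leqNgt il.
rewrite (eq_big_nat _ _ (F2 := fun=> 1)) => [|l /andP[_ li]]; last first.
  by rewrite -ltnS li IH// ?ltnS ?leq_subr// (leq_trans (leq_subr _ _))// ltnW.
by rewrite sumr_const_nat subn0 mul1r mulVf ?pnatr_eq0.
Qed.

(** Here the window no longer reaches the constant coefficient, so the value is [n / (n + 1)], the
    first deviation of [g] from [1 / (1 - X)]. *)
Lemma exp_coef0_gt0 : (0 < n)%N -> 0 < exp_coef 0 n.+1.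
Proof.
move=> n0; rewrite exp_coefS mulr_gt0 ?divr_gt0//.
rewrite (eq_big_nat _ _ (F2 := fun=> 1)) => [|l /andP[_ ln]]; last first.
  by rewrite (ltnW ln) exp_coef0_eq1// leq_subr.
by rewrite sumr_const_nat subn0 ltr0n.
Qed.

(** The first [N] terms of [A_w (X^a g^(a+1)) (1)]. *)
Definition partial_moment a w N : R :=
  \sum_(0 <= i < N) exp_coef a i * moment R n w (a + i).

Lemma partial_moment_window a w N : partial_moment a (true :: w) N =
  \sum_(0 <= t < N + n)
    (\sum_(0 <= l < n.+1) if (l <= t < N + l)%N then exp_coef a (t - l) else 0) *
    (moment R n w (a + t) / (a + t).+1%:R).
Proof.
rewrite -(convolution_sum n (exp_coef a) (fun t => moment R n w (a + t) / (a + t).+1%:R)).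
apply: eq_bigr => i _; rewrite moment_true; congr (_ * _).
by apply: eq_bigr => l _; rewrite addnCA.
Qed.

(** Truncated form of [A_b (X^a g^(a+1)) <= X^a g^(a+1) / (a+1)]. [A_0] is dominated by [A_1],
    incomplete windows only lose nonnegative terms, and the factor [1 + ... + X^n] moves the cut-off
    from [N] to [N + n]. *)
Lemma partial_moment_le a b w N :
  partial_moment a (b :: w) N <= partial_moment a w (N + n) / a.+1%:R.
Proof.
apply: (@le_trans _ _ (partial_moment a (true :: w) N)).
  apply: ler_sum => i _; rewrite ler_wpM2l ?exp_coef_ge0//; case: b => //.
  rewrite moment_false moment_true big_nat_recl// add0n lerDl sumr_ge0// => l _.
  by rewrite divr_ge0// moment_ge0.
rewrite partial_moment_window /partial_moment big_distrl/=; apply: ler_sum => t _.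
have W : \sum_(0 <= l < n.+1) (if (l <= t < N + l)%N then exp_coef a (t - l) else 0)
    <= exp_coef a t * (a + t).+1%:R / a.+1%:R.
  rewrite -exp_coef_window; apply: ler_sum => l _.
  by case: (l <= t)%N => //=; case: ifP => // _; exact: exp_coef_ge0.
rewrite (le_trans (ler_wpM2r _ W)) ?divr_ge0 ?moment_ge0//.
have cancel (x y z v : R) : y != 0 -> x * y / z * (v / y) = x * v / z.
  move=> y0; have -> : x * y / z * (v / y) = x * v / z * (y / y) by ring.
  by rewrite divff// mulr1.
by rewrite cancel// pnatr_eq0.
Qed.

(** For [t < N] the window is complete, and [a = 0] gives the eigenvalue 1; the other terms are
    nonnegative. Together with [partial_moment_le] this gives [A_1 g = g] in the limit. *)
Lemma partial_moment_ge w N :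
  partial_moment 0 w N <= partial_moment 0 (true :: w) N.
Proof.
rewrite partial_moment_window (big_cat_nat (n := N)) ?leq_addr//=.
rewrite ler_wpDr//.
  apply: sumr_ge0 => t _; rewrite mulr_ge0 ?divr_ge0 ?moment_ge0//.
  by apply: sumr_ge0 => l _; case: ifP => // _; exact: exp_coef_ge0.
rewrite /partial_moment [leLHS]big_nat [leRHS]big_nat; apply: ler_sum => t /andP[_ tN].
rewrite add0n; have -> : \sum_(0 <= l < n.+1)
    (if (l <= t < N + l)%N then exp_coef 0 (t - l) else 0) =
    exp_coef 0 t * t.+1%:R.
  rewrite -[RHS]divr1 -exp_coef_window; apply: eq_bigr => l _.
  by rewrite (leq_trans tN) ?leq_addr// andbT.
by rewrite mulrACA divff ?pnatr_eq0// mulr1.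
Qed.

Lemma partial_moment_homo a w : {homo partial_moment a w : N M / (N <= M)%N >-> N <= M}.
Proof.
move=> N M NM; rewrite /partial_moment (big_cat_nat (n := N) (p := M))//= lerDl.
by apply: sumr_ge0 => i _; rewrite mulr_ge0 ?exp_coef_ge0 ?moment_ge0.
Qed.

Lemma partial_moment_bound a : exists2 C : R, 0 < C &
  forall w N, partial_moment a w N <= C / a.+1%:R ^+ size w.
Proof.
have [C C0 hC] := exp_coef_summable a; exists C => // w.
elim: w => [|b w IH] N.
  rewrite divr1 (le_trans _ (hC N))//; apply: ler_sum => i _.
  by rewrite mulr1.
rewrite (le_trans (partial_moment_le _ _ _ _))// [size _]/= exprSr invfM mulrA.
by rewrite ler_wpM2r ?invr_ge0.
Qed.

(** Only the term [i = 0] is used: [X^a <= X^a g^(a+1)], and every letter contracts the latter at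
    least by [1 / (a+1)]. *)
Lemma moment_upper a : exists2 C : R, 0 < C &
  forall w, moment R n w a <= C / a.+1%:R ^+ size w.
Proof.
have [C C0 hC] := partial_moment_bound a; exists C => // w.
by rewrite (le_trans _ (hC w 1%N))// /partial_moment big_nat1 exp_coef0 mul1r addn0.
Qed.

End exp_coefficients.

Lemma limn_nondecreasing (R : realType) (u : R^nat) (B : R) :
  {homo u : i j / (i <= j)%N >-> i <= j} -> (forall i, u i <= B) ->
  [/\ cvgn u, forall i, u i <= limn u & limn u <= B].
Proof.
move=> du uB; have cu : cvgn u.
  by apply: nondecreasing_is_cvgn => //; exists B => _ [i _ <-].
split=> //; first exact: nondecreasing_cvgn_le.
by apply: limr_le => //; exact: nearW.
Qed.

(** * Jumps of [F_n] at dyadic points and their total mass *)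

Section jumps.
Variables (R : realType) (n : nat).
Implicit Types (w : seq bool) (N : nat).

Local Notation moment := (moment R n).
Local Notation partial := (partial_moment R n 0).

(** The value [A_w g (1)]. *)
Definition top_moment w : R := limn (partial w).

Lemma top_momentP w : [/\ cvgn (partial w),
  forall N, partial w N <= top_moment w &
  forall B, (forall N, partial w N <= B) -> top_moment w <= B].
Proof.
have [C _ hC] := partial_moment_bound R n 0.
have hw := limn_nondecreasing (@partial_moment_homo R n 0 w).
have [cv ub _] := hw _ (hC w); split=> // B wB.
by have [] := hw _ wB.
Qed.

Lemma partial_le_top w N : partial w N <= top_moment w.
Proof. by have [_ + _] := top_momentP w; exact. Qed.

Lemma top_moment_le w B : (forall N, partial w N <= B) -> top_moment w <= B.
Proof. by have [_ _] := top_momentP w; exact. Qed.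

Lemma top_moment_true w : top_moment (true :: w) = top_moment w.
Proof.
apply/eqP; rewrite eq_le; apply/andP; split; apply: top_moment_le => N.
  by rewrite (le_trans (partial_moment_le _ _ _ _ _ _))// divr1 partial_le_top.
by rewrite (le_trans (partial_moment_ge _ _ _ _))// partial_le_top.
Qed.

Lemma top_moment_false w : top_moment (false :: w) <= top_moment w.
Proof.
apply: top_moment_le => N.
by rewrite (le_trans (partial_moment_le _ _ _ _ _ _))// divr1 partial_le_top.
Qed.

Lemma moment_le_top w : moment w 0 <= top_moment w.
Proof.
by rewrite (le_trans _ (partial_le_top w 1))// /partial_moment big_nat1 mul1r.
Qed.

(* Bounds the oscillation of [F_n] on the cylinder [w]. *)
Lemma top_moment_width : exists2 C : R, 0 < C &
  forall w, top_moment w - moment w 0 <= C / 2 ^+ size w.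
Proof.
have [A A0 hA] := exp_coef_summable R n 0.
have [B B0 hB] := moment_upper R n 1.
exists (A * B) => [|w]; first exact: mulr_gt0.
rewrite lerBlDl; apply: top_moment_le => -[|N].
  rewrite /partial_moment big_nil addr_ge0 ?moment_ge0// divr_ge0// mulr_ge0// ltW//.
(* The constant term of [g] cancels [moment w 0]; each remaining moment is at most [moment w 1], of
   order [2^-|w|]. *)
rewrite /partial_moment big_nat_recl// mul1r lerD2l.
apply: (@le_trans _ _ (\sum_(0 <= i < N) exp_coef R n 0 i.+1 * moment w 1)).
  by apply: ler_sum => i _; rewrite ler_wpM2l ?exp_coef_ge0// moment_antitone.
rewrite -mulr_suml -mulrA ler_pM ?moment_ge0//.
  by apply: sumr_ge0 => i _; exact: exp_coef_ge0.
by rewrite (le_trans _ (hA N.+1))// big_nat_recl// lerDr.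
Qed.

Definition jump w : R := top_moment (false :: w) - moment (true :: w) 0.

(** This is [A_1 1 = A_0 (1 + X + ... + X^n)]; it lets the jump be compared with the tail of [g]
    beyond degree [n]. *)
Lemma moment_true0_sum w :
  moment (true :: w) 0 = \sum_(0 <= l < n.+1) moment (false :: w) l.
Proof.
by rewrite moment_true; apply: eq_bigr => l _; rewrite addn0 moment_false.
Qed.

(** The coefficients of [g] up to degree [n] equal 1 and cancel [moment (true :: w) 0]; of the tail,
    the term in [X^(n+1)] alone suffices by [moment_lower]. *)
Lemma jump_lower : (0 < n)%N -> exists2 c : R, 0 < c &
  forall w, c / n.+2%:R ^+ size w <= jump w.
Proof.
move=> n0; exists (exp_coef R n 0 n.+1 / n.+2%:R) => [|w].
  by rewrite divr_gt0// exp_coef0_gt0.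
rewrite lerBrDl moment_true0_sum (le_trans _ (partial_le_top _ n.+2))//.
rewrite /partial_moment [leRHS]big_nat_recr//=; apply: lerD.
  rewrite [leLHS]big_nat [leRHS]big_nat; apply: ler_sum => l /andP[_ ln].
  by rewrite exp_coef0_eq1// mul1r.
have := moment_lower R n (false :: w) n.+1.
rewrite -mulrA -invfM -exprS => h; rewrite ler_wpM2l//.
exact/ltW/exp_coef0_gt0.
Qed.

Lemma jump_upper : exists2 C : R, 0 < C &
  forall w, jump w <= C / n.+2%:R ^+ size w.
Proof.
have [A A0 hA] := exp_coef_summable R n 0.
have [B B0 hB] := moment_upper R n n.+1.
exists (A * B) => [|w]; first exact: mulr_gt0.
rewrite lerBlDl; apply: top_moment_le => N.
rewrite (le_trans (partial_moment_homo _ _ _ _ (leq_addl n.+1 N)))//.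
rewrite {1}/partial_moment (big_cat_nat (n := n.+1)) ?leq_addr//; apply: lerD.
  rewrite moment_true0_sum big_nat [leRHS]big_nat; apply: ler_sum => l /andP[_ ln].
  by rewrite exp_coef0_eq1// mul1r.
apply: (@le_trans _ _ (\sum_(n.+1 <= i < n.+1 + N)
    exp_coef R n 0 i * moment (false :: w) n.+1)).
  rewrite [leLHS]big_nat [leRHS]big_nat; apply: ler_sum => i /andP[ni _].
  by rewrite ler_wpM2l ?exp_coef_ge0// moment_antitone.
rewrite -mulr_suml -mulrA ler_pM ?moment_ge0//.
- by apply: sumr_ge0 => i _; exact: exp_coef_ge0.
- rewrite (le_trans _ (hA (n.+1 + N)%N))// [leRHS](big_cat_nat (n := n.+1)) ?leq_addr//=.
  by rewrite lerDr sumr_ge0// => i _; exact: exp_coef_ge0.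
- rewrite moment_false ler_pdivrMr// (le_trans (hB w))// ler_peMr ?divr_ge0 ?ltW//.
  by rewrite ltr1n.
Qed.

Fixpoint partial_mass w N : R :=
  if N is N'.+1 then
    jump w + (partial_mass (false :: w) N' + partial_mass (true :: w) N')
  else 0.

(* Total size of the jumps at the dyadic points inside the cylinder [w]. *)
Definition mass w : R := limn (partial_mass w).

Hypothesis n_gt0 : (0 < n)%N.

Lemma jump_gt0 w : 0 < jump w.
Proof.
have [c c0 hc] := jump_lower n_gt0.
by rewrite (lt_le_trans _ (hc w))// divr_gt0// exprn_gt0.
Qed.

Lemma partial_mass_homo w :
  {homo partial_mass w : N M / (N <= M)%N >-> N <= M}.
Proof.
suff step N v : partial_mass v N <= partial_mass v N.+1.
  by apply: homo_leq => //; exact: le_trans.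
elim: N v => [|N IH] v; first by rewrite /= !addr0 ltW// jump_gt0.
by rewrite [leLHS]/= [leRHS]/= lerD2l lerD.
Qed.

Lemma partial_mass_upper : exists2 C : R, 0 < C &
  forall w N, partial_mass w N <= C / n.+2%:R ^+ size w.
Proof.
(* [M = 3 * C] satisfies [C + 2 M / 3 <= M]: there are two subcylinders, each scaled by
   [1 / (n + 2) <= 1 / 3]. *)
have [C C0 hC] := jump_upper; exists (3 * C) => [|w N]; first exact: mulr_gt0.
elim: N w => [|N IH] w /=.
  by rewrite divr_ge0 ?mulr_ge0// ltW.
rewrite (le_trans (lerD (hC w) (lerD (IH (false :: w)) (IH (true :: w)))))//.
rewrite [size _]/= [size (true :: _)]/= exprS.
set x : R := n.+2%:R; set y := x ^+ size w.
have x3 : 3 <= x by rewrite ler_nat ltnS.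
have y0 : 0 < y by rewrite exprn_gt0// (lt_le_trans _ x3).
have x0 : 0 < x by rewrite (lt_le_trans _ x3).
rewrite invfM mulrA [X in _ + (X + X)]mulrAC [X in _ + (X + X)]mulrC; clearbody x y.
have -> : C / y + (x^-1 * (3 * C / y) + x^-1 * (3 * C / y)) =
   (C / y) * (1 + 6 / x) by ring.
rewrite [leRHS](_ : _ = (C / y) * 3); last by ring.
have Cy : 0 <= C / y by rewrite divr_ge0// ltW.
by rewrite ler_wpM2l// -lerBrDl ler_pdivrMr//; lra.
Qed.

Lemma massP w : [/\ cvgn (partial_mass w),
  forall N, partial_mass w N <= mass w &
  forall B, (forall N, partial_mass w N <= B) -> mass w <= B].
Proof.
have [C _ hC] := partial_mass_upper.
have hw := limn_nondecreasing (@partial_mass_homo w).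
have [cv ub _] := hw _ (hC w); split=> // B wB.
by have [] := hw _ wB.
Qed.

Lemma mass_upper : exists2 C : R, 0 < C &
  forall w, mass w <= C / n.+2%:R ^+ size w.
Proof.
have [C C0 hC] := partial_mass_upper; exists C => // w.
by have [_ _] := massP w; apply.
Qed.

Lemma mass_gt0 w : 0 < mass w.
Proof.
have [_ /(_ 1%N) + _] := massP w; rewrite /= !addr0.
exact/lt_le_trans/jump_gt0.
Qed.

Lemma mass_split w : mass w = jump w + (mass (false :: w) + mass (true :: w)).
Proof.
have [_ uw lw] := massP w; have [_ u0 l0] := massP (false :: w).
have [_ u1 l1] := massP (true :: w).
apply/eqP; rewrite eq_le; apply/andP; split.
  apply: lw => -[|N]; last by rewrite lerD2l lerD.
  by rewrite addr_ge0 ?ltW ?jump_gt0// addr_gt0 ?mass_gt0.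
rewrite -lerBrDl -lerBrDr; apply: l0 => N.
rewrite lerBrDl -lerBrDr; apply: l1 => M.
rewrite lerBrDr lerBrDl (le_trans _ (uw (maxn N M).+1))//= lerD2l addrC.
by rewrite lerD// partial_mass_homo// ?leq_maxl ?leq_maxr.
Qed.

End jumps.

Lemma exp2_small (R : realType) (e : R) : 0 < e -> exists K : nat, (2 ^+ K)^-1 < e.
Proof.
move=> e0; exists (Num.bound e^-1); rewrite invf_plt ?posrE ?exprn_gt0//.
rewrite (lt_trans (archi_boundP _))// ?invr_ge0 ?ltW//.
by rewrite -natrX ltr_nat ltn_expl.
Qed.

(** * Nested families of intervals indexed by binary words *)

Section nested_intervals.
Variable R : realType.
Implicit Types (L U : seq bool -> R) (w u s : seq bool) (b : nat -> bool).

Fixpoint rprefix b K : seq bool := if K is K'.+1 then b K' :: rprefix b K' else [::].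

Lemma size_rprefix b K : size (rprefix b K) = K.
Proof. by elim: K => //= K ->. Qed.

(** [L] and [U] are bounds on the cylinder [w]: appending a zero keeps the lower one, appending a
    one the upper one. How [U (false :: w)] compares with [L (true :: w)] is left open: dyadic
    intervals touch, Cantor intervals with [m > 2] and the bounds of [H] leave a gap, those of [F_n]
    overlap. *)
Definition nested L U := forall w,
  [/\ L (false :: w) = L w, L w <= L (true :: w),
      U (true :: w) = U w, U (false :: w) <= U w & L w <= U w].

Definition value L b : R := limn (fun K => L (rprefix b K)).

Lemma first_difference b b' i : b i != b' i ->
  exists2 K, rprefix b K = rprefix b' K & b K != b' K.
Proof.
move=> bi; have ex : exists j, b j != b' j by exists i.
case: (ex_minnP ex) => K bK Kmin; exists K => //.
have : (K <= K)%N by [].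
elim: {-2}K => //= j IH jK; rewrite IH ?(ltnW jK)//; congr (_ :: _).
by apply/eqP/negPn/negP => /Kmin; rewrite leqNgt jK.
Qed.

Section fixed.
Variables (L U : seq bool -> R).
Hypothesis LU : nested L U.

Lemma nested_lo_cat s w : L w <= L (s ++ w).
Proof.
elim: s => //= -[] s IH; have [L0 L1 _ _ _] := LU (s ++ w).
  exact: le_trans L1.
by rewrite L0.
Qed.

Lemma nested_hi_cat s w : U (s ++ w) <= U w.
Proof.
elim: s => //= -[] s IH; have [_ _ U1 U0 _] := LU (s ++ w).
  by rewrite U1.
exact: le_trans IH.
Qed.

Lemma nested_lo_nseq j w : L (nseq j false ++ w) = L w.
Proof. by elim: j => //= j <-; have [] := LU (nseq j false ++ w). Qed.

Lemma nested_hi_nseq j w : U (nseq j true ++ w) = U w.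
Proof. by elim: j => //= j <-; have [] := LU (nseq j true ++ w). Qed.

Lemma rprefix_cat b K N : (K <= N)%N -> exists s, rprefix b N = s ++ rprefix b K.
Proof.
move=> /subnK <-; elim: (N - K)%N => [|j [s hs]]; first by exists [::].
by exists (b (j + K)%N :: s); rewrite /= hs.
Qed.

Lemma nested_lo_rprefix b : {homo (fun K => L (rprefix b K)) : K N / (K <= N)%N >-> K <= N}.
Proof. by move=> K N /(rprefix_cat b)[s ->]; exact: nested_lo_cat. Qed.

Lemma nested_hi_rprefix b : {homo (fun K => U (rprefix b K)) : K N / (K <= N)%N >-> N <= K}.
Proof. by move=> K N /(rprefix_cat b)[s ->]; exact: nested_hi_cat. Qed.

Lemma nested_lo_hi b K N : L (rprefix b K) <= U (rprefix b N).
Proof.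
have := nested_lo_rprefix b (leq_maxl K N).
have := nested_hi_rprefix b (leq_maxr K N).
have [_ _ _ _] := LU (rprefix b (maxn K N)).
by move=> h h1 h2; rewrite (le_trans h2)// (le_trans h).
Qed.

Lemma valueP b K : L (rprefix b K) <= value L b <= U (rprefix b K).
Proof.
have [_ h1 h2] := limn_nondecreasing (nested_lo_rprefix b) (nested_lo_hi b ^~ K).
by rewrite (h1 K).
Qed.

End fixed.
End nested_intervals.

(** * Cantor intervals and binary expansions *)

Section cantor_words.
Variables (R : realType) (m : nat).
Hypothesis m_gt1 : (1 < m)%N.
Implicit Types (w : seq bool).

(** Left end of a basic interval with digits [0] and [m - 1]; the case [m = 2] gives the dyadic
    intervals, used below as [lo] and [hi]. *)
Fixpoint cantor_lo w : R :=
  if w is b :: w' then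
    cantor_lo w' + (if b then m.-1%:R / m%:R ^+ (size w').+1 else 0)
  else 0.

Definition cantor_hi w : R := cantor_lo w + (m%:R ^+ size w)^-1.

Let m_gt0 : 0 < m%:R :> R. Proof. by rewrite ltr0n (ltnW m_gt1). Qed.

Lemma cantor_hi_true w : cantor_hi (true :: w) = cantor_hi w.
Proof.
rewrite /cantor_hi/= -addrA; congr (_ + _); rewrite -[X in _ + X]mul1r -mulrDl.
rewrite -(natrD _ m.-1 1) addn1 (prednK (ltnW m_gt1)) exprS invfM mulrA divff ?mul1r//.
by rewrite gt_eqF.
Qed.

Lemma cantor_hi_false w : cantor_hi (false :: w) = cantor_lo w + (m%:R ^+ (size w).+1)^-1.
Proof. by rewrite /cantor_hi/= addr0. Qed.

Lemma cantor_lo_false w : cantor_lo (false :: w) = cantor_lo w.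
Proof. by rewrite /= addr0. Qed.

Lemma cantor_lo_true w : cantor_lo (true :: w) = cantor_lo w + m.-1%:R / m%:R ^+ (size w).+1.
Proof. by []. Qed.

Lemma cantor_lo_lt_hi w : cantor_lo w < cantor_hi w.
Proof. by rewrite ltrDl invr_gt0 exprn_gt0. Qed.

Lemma cantor_lo_true_lt w : cantor_lo w < cantor_lo (true :: w).
Proof. by rewrite /= ltrDl divr_gt0 ?exprn_gt0// ltr0n -ltnS (prednK (ltnW m_gt1)). Qed.

Lemma cantor_hi_false_lt w : cantor_hi (false :: w) < cantor_hi w.
Proof.
rewrite cantor_hi_false ltrD2l exprS invfM gtr_pMl ?invr_gt0 ?exprn_gt0//.
by rewrite invf_lt1// ltr1n.
Qed.

Lemma cantor_nested : nested cantor_lo cantor_hi.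
Proof.
move=> w; split.
- exact: cantor_lo_false.
- exact/ltW/cantor_lo_true_lt.
- exact: cantor_hi_true.
- exact/ltW/cantor_hi_false_lt.
- exact/ltW/cantor_lo_lt_hi.
Qed.

Lemma cantor_gap w : cantor_lo (true :: w) - cantor_hi (false :: w) =
  (m - 2)%:R / m%:R ^+ (size w).+1.
Proof.
rewrite cantor_hi_false cantor_lo_true opprD addrACA subrr add0r -[X in _ - X]mul1r.
rewrite -mulrBl (_ : (m - 2)%N = (m.-1 - 1)%N); last by lia.
by rewrite natrB//; lia.
Qed.

Lemma value_cantor_gt (b : nat -> bool) K : (exists2 i, (K <= i)%N & b i) ->
  cantor_lo (rprefix b K) < value cantor_lo b.
Proof.
move=> [i Ki bi]; have /andP[h _] := valueP cantor_nested b i.+1.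
have := nested_lo_rprefix cantor_nested b Ki.
move=> /le_lt_trans; apply; rewrite (lt_le_trans _ h)//= bi.
exact: cantor_lo_true_lt.
Qed.

End cantor_words.

Section binary_digits.
Variable R : realType.
Implicit Types (w : seq bool) (x y : R) (b : nat -> bool).

Definition lo : seq bool -> R := cantor_lo R 2.
Definition hi : seq bool -> R := cantor_hi R 2.

Lemma lohi_nested : nested lo hi. Proof. exact: cantor_nested. Qed.

Lemma hi_false w : hi (false :: w) = lo (true :: w).
Proof.
by apply/eqP; rewrite -subr_eq0 -opprB oppr_eq0 /lo /hi cantor_gap// mul0r.
Qed.

Lemma hiE w : hi w = lo w + (2 ^+ size w)^-1. Proof. by []. Qed.

Fixpoint digit_prefix x K : seq bool :=
  if K is K'.+1 then (lo (true :: digit_prefix x K') < x) :: digit_prefix x K' else [::].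

(* Binary digits of the expansion of [x] with infinitely many ones. *)
Definition digit x K : bool := lo (true :: digit_prefix x K) < x.

Definition prefix x K := rprefix (digit x) K.

Lemma digit_prefixE x K : digit_prefix x K = prefix x K.
Proof. by rewrite /prefix; elim: K => //= K <-. Qed.

Lemma digitE x K : digit x K = (lo (true :: prefix x K) < x).
Proof. by rewrite -digit_prefixE. Qed.

Lemma prefixS x K : prefix x K.+1 = digit x K :: prefix x K. Proof. by []. Qed.

Lemma size_prefix x K : size (prefix x K) = K.
Proof. exact: size_rprefix. Qed.

(** Cylinders are open on the left and closed on the right, so a dyadic point falls into the
    cylinder on its left; hence the strict comparison in [digit]. *)
Lemma prefixP x K : 0 < x <= 1 -> lo (prefix x K) < x <= hi (prefix x K).
Proof.
move=> x01; elim: K => [|K /andP[lx xh]].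
  by rewrite hiE/= add0r invr1.
rewrite prefixS digitE; have [lt|ge] := boolP (lo (true :: prefix x K) < x).
  by rewrite lt /=; have [_ _ -> _ _] := lohi_nested (prefix x K).
have [-> _ _ _ _] := lohi_nested (prefix x K).
by rewrite lx hi_false leNgt.
Qed.

Lemma prefix_unique x w : lo w < x <= hi w -> prefix x (size w) = w.
Proof.
elim: w => // b w IH /andP[lx xh].
have [L0 L1 U1 U0 _] := lohi_nested w.
have IHw : prefix x (size w) = w.
  apply: IH; apply/andP; split.
    by rewrite (le_lt_trans _ lx)//; case: b lx xh; rewrite ?L0.
  by rewrite (le_trans xh)//; case: b lx xh; rewrite ?U1.
rewrite prefixS digitE IHw; congr (_ :: _).
case: b lx xh => // _; rewrite hi_false => h.
by apply/negbTE; rewrite -leNgt.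
Qed.

(** With only zeros from [K] on, the left ends would stay constant while the lengths tend to 0,
    against the strict inequality of [prefixP]. *)
Lemma digit_infinitely_often x K : 0 < x <= 1 -> exists2 i, (K <= i)%N & digit x i.
Proof.
move=> x01; apply: contrapT => h.
have /andP[lx _] := prefixP K x01.
have [J hJ] := @exp2_small R (x - lo (prefix x K)) (etrans (subr_gt0 _ _) lx).
have E j : lo (prefix x (j + K)) = lo (prefix x K).
  elim: j => // j IH; rewrite addSn prefixS.
  have -> : digit x (j + K) = false.
    by apply/negP => dj; apply: h; exists (j + K)%N => //; exact: leq_addl.
  by have [-> _ _ _ _] := lohi_nested (prefix x (j + K)).
have /andP[_] := prefixP (J + K) x01.
rewrite hiE E size_prefix -lerBlDl leNgt => /negP; apply.
rewrite (le_lt_trans _ hJ)// lef_pV2 ?posrE ?exprn_gt0//.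
by rewrite ler_weXn2l ?ler1n// leq_addr.
Qed.

Lemma digit_first_difference x y : 0 < x <= 1 -> 0 < y <= 1 -> x < y ->
  exists K, [/\ prefix x K = prefix y K, digit x K = false & digit y K = true].
Proof.
move=> x01 y01 xy.
have [i di] : exists i, digit x i != digit y i.
  apply: contrapT => h; have eqd i : digit x i = digit y i.
    by apply/eqP/negPn/negP => hi; apply: h; exists i.
  have eqp K : prefix x K = prefix y K by rewrite /prefix; elim: K => //= K ->; rewrite eqd.
  have [K hK] := @exp2_small R (y - x) (etrans (subr_gt0 _ _) xy).
  have /andP[lx _] := prefixP K x01; have /andP[_] := prefixP K y01.
  rewrite hiE -eqp size_prefix => yh; move: hK; rewrite ltrBrDr addrC ltNge => /negP; apply.
  by rewrite (le_trans yh)// lerD2r ltW.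
have [K pK dK] := first_difference di; exists K.
have pxy : prefix x K = prefix y K by [].
have [dx|dx] := boolP (digit x K); have [dy|dy] := boolP (digit y K).
- by rewrite dx dy in dK.
- move: dx dy; rewrite !digitE -pxy -leNgt => h1 h2.
  by have := lt_trans (lt_le_trans h1 (ltW xy)) (le_lt_trans h2 h1); lra.
- by [].
- by rewrite (negbTE dx) (negbTE dy) in dK.
Qed.

Lemma rprefix_digit b : (forall K, exists2 i, (K <= i)%N & b i) ->
  exists2 x, 0 < x <= 1 & forall K, prefix x K = rprefix b K.
Proof.
move=> bio; pose x := value lo b.
have h K : lo (rprefix b K) < x <= hi (rprefix b K).
  rewrite value_cantor_gt//; first by have /andP[] := valueP lohi_nested b K.
have x01 : 0 < x <= 1 by have := h 0%N; rewrite hiE /= add0r expr0 invr1.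
by exists x => // K; rewrite -(prefix_unique (h K)) size_rprefix.
Qed.

End binary_digits.

(** * The map [tau] in terms of binary digits *)

Section expansions.
Variable R : realType.
Implicit Types (k : nat -> nat) (x : R) (w : seq bool).

Definition sequence_word k r : seq bool := rev (word (mkseq k r)).

Lemma sequence_wordS k r : sequence_word k r.+1 =
  true :: nseq (k r).-1 false ++ sequence_word k r.
Proof.
rewrite /sequence_word mkseqS /word map_rcons flatten_rcons rev_cat /block rev_rcons.
by rewrite rev_nseq.
Qed.

Lemma size_sequence_word k r : That k ->
  size (sequence_word k r) = (\sum_(0 <= i < r) k i)%N.
Proof.
move=> k0; elim: r => [|r IH]; first by rewrite big_nil.
rewrite sequence_wordS /= size_cat size_nseq IH big_nat_recr//=.
by rewrite addnC -addnS prednK ?k0.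
Qed.

Lemma leq_size_sequence_word k r : That k -> (r <= size (sequence_word k r))%N.
Proof.
move=> k0; elim: r => // r IH; rewrite sequence_wordS /= size_cat ltnS.
exact: leq_trans (leq_addl _ _).
Qed.

Lemma lo_sequence_word k r : That k ->
  lo R (sequence_word k r) = series (fun r => 2 ^- (\sum_(0 <= i < r.+1) k i)%N) r.
Proof.
move=> k0; elim: r => [|r IH]; first by rewrite /series/= big_nil.
rewrite sequence_wordS seriesSr -IH {1}/lo cantor_lo_true -/(lo R _).
rewrite (nested_lo_nseq (lohi_nested R)) mul1r size_cat size_nseq -addSn prednK ?k0//.
by rewrite size_sequence_word// [in RHS]big_nat_recr//= addnC.
Qed.

Lemma sequence_word_cat k r s : (r <= s)%N ->
  exists w, sequence_word k s = w ++ sequence_word k r.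
Proof.
move=> /subnK <-; elim: (s - r)%N => [|j [w hw]]; first by exists [::].
exists (true :: nseq (k (j + r)%N).-1 false ++ w).
by rewrite addSn sequence_wordS hw /= catA.
Qed.

(** The partial sums of [tau] are left ends of nested cylinders; the lower inequality is strict
    because the next block adds another one. *)
Lemma tau_sequence_word k r : That k ->
  lo R (sequence_word k r) < tau R k <= hi R (sequence_word k r).
Proof.
move=> k0; rewrite /tau (_ : series _ = fun r => lo R (sequence_word k r)); last first.
  by apply/funext => i; rewrite lo_sequence_word.
have nd : {homo (fun r => lo R (sequence_word k r)) : i j / (i <= j)%N >-> i <= j}.
  by move=> i j /(sequence_word_cat k)[w ->]; exact: nested_lo_cat (lohi_nested R) _ _.
have ub i : lo R (sequence_word k i) <= hi R (sequence_word k r).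
  rewrite (le_trans (nd _ _ (leq_maxl i r)))//.
  have [w ->] := sequence_word_cat k (leq_maxr i r).
  have [_ _ _ _ h] := lohi_nested R (w ++ sequence_word k r).
  by rewrite (le_trans h)// (nested_hi_cat (lohi_nested R)).
have [_ h1 ->] := limn_nondecreasing nd ub.
rewrite andbT (lt_le_trans _ (h1 r.+1))// sequence_wordS.
rewrite -[ltLHS](nested_lo_nseq (lohi_nested R) (k r).-1).
exact: cantor_lo_true_lt.
Qed.

Lemma tau_itv k : That k -> 0 < tau R k <= 1.
Proof.
by move=> /(tau_sequence_word 0); rewrite /sequence_word /= hiE /= expr0 invr1 add0r.
Qed.

Lemma prefix_tau k r : That k ->
  prefix (tau R k) (size (sequence_word k r)) = sequence_word k r.
Proof. by move=> k0; apply/prefix_unique/tau_sequence_word. Qed.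

Lemma tau_surj x : 0 < x <= 1 -> exists2 k, That k & tau R k = x.
Proof.
move=> x01.
(* Greedy choice: the least [j] with [2 ^+ j * y > 1] leaves a rescaled remainder in []0, 1]], to
   which the choice applies again. *)
have step (y : R) : exists j : nat, 0 < y <= 1 -> (0 < j)%N /\ 0 < 2 ^+ j * y - 1 <= 1.
  have [/andP[y0 y1]|h] := boolP (0 < y <= 1); last by exists 0%N.
  have [j hj] := exp2_small y0.
  have ex : exists j, 1 < 2 ^+ j * y.
    by exists j; rewrite -ltr_pdivrMl ?exprn_gt0// mulr1.
  case: (ex_minnP ex) => i hi imin; exists i => _.
  case: i hi imin => [|i]; first by rewrite expr0 mul1r ltNge y1.
  move=> hi /(_ i); rewrite ltnn subr_gt0 hi => /contraFN/(_ erefl).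
  rewrite -leNgt => h; split=> //=.
  by rewrite exprS -mulrA; move: (2 ^+ i * y) h => z; lra.
have [d hd] := choice step.
pose y r : R := iter r (fun y => 2 ^+ (d y) * y - 1) x.
have y01 r : 0 < y r <= 1 by elim: r => //= r IH; have [] := hd _ IH.
pose k r := d (y r).
have k0 : That k by move=> r; have [] := hd _ (y01 r).
exists k => //.
have E r : x = series (fun r => 2 ^- (\sum_(0 <= i < r.+1) k i)%N) r
    + y r / 2 ^+ (\sum_(0 <= i < r) k i)%N.
  elim: r => [|r IH]; first by rewrite /series/= !big_nil add0r divr1.
  rewrite {1}IH seriesSr -addrA; congr (_ + _); rewrite [in RHS]big_nat_recr//= exprD.
  have k2 : 2 ^+ k r != 0 :> R by rewrite expf_neq0.
  have q2 : 2 ^+ (\sum_(0 <= i < r) k i)%N != 0 :> R by rewrite expf_neq0.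
  rewrite -/(y r) -/(k r); move: (2 ^+ k r) (2 ^+ (\sum_(0 <= i < r) k i)%N) k2 q2 => z q z0 q0.
  by field; rewrite z0 q0.
(* Both [x] and [tau R k] exceed the [r]-th partial sum by at most [2^-(k_1 + ... + k_r)], which is
   at most [2^-r]. *)
apply/eqP; rewrite -subr_eq0 -normr_le0 leNgt; apply/negP => xt.
have [r hr] := exp2_small xt; move: hr; apply/negP; rewrite -leNgt.
apply: (@le_trans _ _ (2 ^+ size (sequence_word k r))^-1); last first.
  rewrite lef_pV2 ?posrE ?exprn_gt0// ler_weXn2l ?ler1n//.
  exact: leq_size_sequence_word.
have /andP[t1 t2] := tau_sequence_word r k0; rewrite hiE in t2.
have xE := E r; rewrite -lo_sequence_word// -size_sequence_word// in xE.
have /andP[y0 y1] := y01 r.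
have q0 : 0 < (2 ^+ size (sequence_word k r))^-1 :> R by rewrite invr_gt0 exprn_gt0.
rewrite ler_norml xE; move: (lo R _) (_^-1) q0 t1 t2 => l q q0 t1 t2.
by apply/andP; split; nra.
Qed.

End expansions.

(** * The decomposition *)

Section bracketed_functions.
Variable R : realType.
Implicit Types (f g : R -> R) (L U : seq bool -> R) (x y : R) (w : seq bool).

Definition bracketed f L U := forall x K, 0 < x <= 1 ->
  L (prefix x K) <= f x <= U (prefix x K).

Lemma bracketedD f g L U L' U' : bracketed f L U -> bracketed g L' U' ->
  bracketed (f \+ g) (L \+ L') (U \+ U').
Proof.
move=> hf hg x K x01; have /andP[f1 f2] := hf x K x01; have /andP[g1 g2] := hg x K x01.
by rewrite /= !lerD.
Qed.

Lemma nestedD L U L' U' : nested L U -> nested L' U' -> nested (L \+ L') (U \+ U').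
Proof.
move=> h h' w; have [a b c d e] := h w; have [a' b' c' d' e'] := h' w.
by split; rewrite /= ?a ?a' ?c ?c' ?lerD.
Qed.

Definition straddle x y K :=
  prefix x K.+1 = false :: prefix x K /\ prefix y K.+1 = true :: prefix x K.

Lemma straddleP x y : 0 < x <= 1 -> 0 < y <= 1 -> x < y -> exists K, straddle x y K.
Proof.
move=> x01 y01 xy; have [K [pxy dx dy]] := digit_first_difference x01 y01 xy.
by exists K; split; rewrite prefixS ?dx ?dy ?pxy.
Qed.

Lemma bracketed_gap f L U x y K : nested L U -> bracketed f L U ->
  0 < x <= 1 -> 0 < y <= 1 -> straddle x y K ->
  L (true :: prefix x K) - U (false :: prefix x K) <= f y - f x
    <= U (prefix x K) - L (prefix x K).
Proof.
move=> LU hf x01 y01 [px py].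
have := hf x K.+1 x01; have := hf y K.+1 y01; rewrite px py.
have [L0 _ U1 _ _] := LU (prefix x K); rewrite L0 U1 => /andP[h1 h2] /andP[h3 h4].
by rewrite !lerB.
Qed.

(* Without gaps and with oscillation [C 2^-K] on cylinders of level [K], the two points
   of a pair straddling the dyadic point separating two cylinders are each compared
   with that point. *)
Lemma bracketed_modulus f L U (C : R) : nested L U -> bracketed f L U ->
  (forall w, L (true :: w) <= U (false :: w)) ->
  (forall w, U w - L w <= C / 2 ^+ size w) ->
  forall x y J, 0 < x <= 1 -> 0 < y <= 1 -> x < y -> y - x < (2 ^+ J)^-1 ->
  f y - f x <= 2 * C / 2 ^+ J.
Proof.
move=> LU hf gap width x y J x01 y01 xy xyJ.
have C0 : 0 <= C.
  have [_ _ _ _] := LU [::]; rewrite -subr_ge0 => h.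
  by rewrite (le_trans h)// (le_trans (width _))// divr1.
have [K [px py]] := straddleP x01 y01 xy.
set w := prefix x K in px py.
have sw : size w = K by rewrite size_prefix.
have /andP[lx xh] := prefixP K.+1 x01; have /andP[ly yh] := prefixP K.+1 y01.
rewrite px in lx xh; rewrite py in ly yh.
have shrink N u : size u = N -> (J <= N)%N -> U u - L u <= C / 2 ^+ J.
  move=> uN JN; rewrite (le_trans (width u))// uN ler_wpM2l//.
  by rewrite lef_pV2 ?posrE ?exprn_gt0// ler_weXn2l ?ler1n.
have hy : f y - L (true :: w) <= C / 2 ^+ J.
  have [KJ|JK] := leqP K.+1 J; last first.
    rewrite (le_trans _ (shrink K.+1 (true :: w) _ (ltnW JK)))//= ?sw// lerB//.
    by have := hf y K.+1 y01; rewrite py => /andP[].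
  (* [y] is less than [2^-J] above the separating dyadic point, so its digits continue with zeros up
     to level [J], which keeps [L]. Symmetrically, the digits of [x] below continue with ones and
     keep [U]. *)
  pose u := nseq (J - K.+1) false ++ true :: w.
  have su : size u = J by rewrite size_cat size_nseq /= sw subnK.
  have pu : prefix y J = u.
    rewrite -su; apply: prefix_unique; rewrite hiE su.
    rewrite (nested_lo_nseq (lohi_nested R)) ly andTb.
    by rewrite hi_false in xh; lra.
  have := hf y J y01; rewrite pu => /andP[_ h].
  by rewrite (le_trans _ (shrink J u su _))// lerB// (nested_lo_nseq LU).
have hx : U (false :: w) - f x <= C / 2 ^+ J.
  have [KJ|JK] := leqP K.+1 J; last first.
    rewrite (le_trans _ (shrink K.+1 (false :: w) _ (ltnW JK)))//= ?sw// lerB//.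
    by have := hf x K.+1 x01; rewrite px => /andP[].
  pose u := nseq (J - K.+1) true ++ false :: w.
  have su : size u = J by rewrite size_cat size_nseq /= sw subnK.
  have pu : prefix x J = u.
    rewrite -su; apply: prefix_unique.
    have hu : hi R u = hi R (false :: w) := nested_hi_nseq (lohi_nested R) _ _.
    have := hiE R u; rewrite su hu hi_false => hE.
    by rewrite hi_false in xh; rewrite xh andbT; lra.
  have := hf x J x01; rewrite pu => /andP[h _].
  by rewrite (le_trans _ (shrink J u su _))// lerB// (nested_hi_nseq LU).
rewrite (_ : 2 * C / _ = C / 2 ^+ J + C / 2 ^+ J); last by ring.
by move: (C / _) hx hy (gap w) => q hx hy gw; lra.
Qed.

End bracketed_functions.

(** * The increasing functions [H] and [G] *)

Section decomposition.
Variables (R : realType) (n : nat).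
Hypothesis n_gt0 : (0 < n)%N.
Implicit Types (x y : R) (w : seq bool).

Local Notation moment0 := (fun w => moment R n w 0).

Lemma moment_nested : nested moment0 (top_moment R n).
Proof.
move=> w; split.
- exact: moment_false0.
- exact: moment_true0.
- exact: top_moment_true.
- exact: top_moment_false.
- exact: moment_le_top.
Qed.

Lemma all_gt0_mkseq k r : That k -> all (leq 1) (mkseq k r).
Proof. by move=> k0; apply/allP => _ /mapP[i _ ->]; exact: k0. Qed.

(** By [prefix_tau] the integrals [T_n] are moments along prefixes of [x], hence nondecreasing in
    [r] and bounded by the top moment of every prefix; blocks being nonempty, the first [K] of them
    cover the first [K] digits. *)
Lemma F_n_bracketed : bracketed (@F_n R n) moment0 (top_moment R n).
Proof.
move=> x K x01; rewrite /F_n /=; set k := pinv That (@tau R) x.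
have [k' k'0 tk'] := tau_surj x01.
have k0 : That k.
  apply: (@surjpinv_image_sub _ _ _ That (@tau R @` That) (@tau R)) => //.
  by exists x => //; exists k'.
have xE : tau R k = x by rewrite pinvK// inE; exists k'.
have pk r := prefix_tau R r k0.
rewrite xE in pk; rewrite /eta_n.
have -> : (fun r => T_n R n (mkseq k r)) =
    fun r => moment0 (prefix x (size (sequence_word k r))).
  by apply/funext => r; rewrite T_n_moment ?all_gt0_mkseq// pk.
have nd : {homo (fun r => moment0 (prefix x (size (sequence_word k r)))) :
    i j / (i <= j)%N >-> i <= j}.
  move=> i j /(sequence_word_cat k)[w wE]; rewrite !pk wE.
  exact: nested_lo_cat moment_nested _ _.
have ub r : moment0 (prefix x (size (sequence_word k r))) <= top_moment R n (prefix x K).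
  exact: nested_lo_hi moment_nested _ _ _.
have [_ h ->] := limn_nondecreasing nd ub.
rewrite andbT (le_trans _ (h K))//.
apply: (nested_lo_rprefix moment_nested (digit x)).
exact: leq_size_sequence_word.
Qed.

Lemma moment_true0_gt1 w : 1 < moment R n (true :: w) 0.
Proof.
rewrite moment_true; case: n n_gt0 => // n' _.
rewrite !big_nat_recl//= !addn0 divr1 -[ltLHS]addr0.
have h0 := moment_lower R n'.+1 w 0; rewrite expr1n invr1 in h0.
have h1 : 0 < moment R n'.+1 w 1.
  by rewrite (lt_le_trans _ (moment_lower R n'.+1 w 1))// invr_gt0 exprn_gt0.
rewrite ler_ltD// ltr_wpDr ?divr_gt0// sumr_ge0// => i _.
by rewrite divr_ge0// moment_ge0.
Qed.

Lemma F_n_gt1 x : 0 < x <= 1 -> 1 < F_n n x.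
Proof.
move=> x01; have [i _ di] := digit_infinitely_often 0 x01.
have /andP[h _] := F_n_bracketed i.+1 x01.
by rewrite (lt_le_trans _ h)// prefixS di moment_true0_gt1.
Qed.

(* [jump_lo w] adds up the jumps at all dyadic points to the left of the cylinder
   [w]. The offset [2] makes [H] larger than [1]. *)
Fixpoint jump_lo w : R :=
  if w is b :: w' then
    jump_lo w' + (if b then jump R n w' + mass R n (false :: w') else 0)
  else 2.

Definition jump_hi w : R := jump_lo w + mass R n w.

Lemma jump_gap w : jump_lo (true :: w) - jump_hi (false :: w) = jump R n w.
Proof. by rewrite /jump_hi /=; ring. Qed.

Lemma jump_hi_true w : jump_hi (true :: w) = jump_hi w.
Proof. by rewrite /jump_hi/= [in RHS]mass_split//; ring. Qed.

Lemma jump_lo_true_lt w : jump_lo w < jump_lo (true :: w).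
Proof. by rewrite /= ltrDl addr_gt0// ?jump_gt0 ?mass_gt0. Qed.

Lemma jump_nested : nested jump_lo jump_hi.
Proof.
move=> w; split.
- by rewrite /= addr0.
- exact/ltW/jump_lo_true_lt.
- exact: jump_hi_true.
- rewrite /jump_hi /= addr0 lerD2l [leRHS]mass_split// addrCA lerDl.
  by rewrite ltW// addr_gt0// ?jump_gt0 ?mass_gt0.
- by rewrite lerDl ltW// mass_gt0.
Qed.

(** The function [H]: the dyadic points to the left of [x] are exhausted by those to the left of its
    cylinders. *)
Definition jump_part x : R := value jump_lo (digit x).

Lemma jump_part_bracketed : bracketed jump_part jump_lo jump_hi.
Proof. by move=> x K _; exact: valueP jump_nested _ _. Qed.

Lemma jump_part_gt x K : 0 < x <= 1 -> jump_lo (prefix x K) < jump_part x.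
Proof.
move=> x01; have [i Ki di] := digit_infinitely_often K x01.
have /andP[h _] := jump_part_bracketed i.+1 x01.
rewrite (lt_le_trans _ h)// prefixS di (le_lt_trans _ (jump_lo_true_lt _))//.
exact: nested_lo_rprefix jump_nested _ _ _ Ki.
Qed.

(** The left inequality is strict because [y] has further ones; this is what makes [G] strictly
    increasing. *)
Lemma jump_part_gap x y K : 0 < x <= 1 -> 0 < y <= 1 -> straddle x y K ->
  jump R n (prefix x K) < jump_part y - jump_part x <= mass R n (prefix x K).
Proof.
move=> x01 y01 xyK; apply/andP; split.
  have := jump_part_gt K.+1 y01; have /andP[_] := jump_part_bracketed K.+1 x01.
  by case: xyK => -> ->; rewrite -jump_gap; lra.
have /andP[_ h] := bracketed_gap jump_nested jump_part_bracketed x01 y01 xyK.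
by rewrite (le_trans h)// /jump_hi addrC addKr.
Qed.

Lemma jump_part_incr x y : 0 < x <= 1 -> 0 < y <= 1 -> x < y -> jump_part x < jump_part y.
Proof.
move=> x01 y01 xy; have [K xyK] := straddleP x01 y01 xy.
have /andP[h _] := jump_part_gap x01 y01 xyK.
by rewrite -subr_gt0 (lt_trans _ h)// jump_gt0.
Qed.

Definition continuous_part x : R := F_n n x + jump_part x.

(** Across the dyadic point separating [x] and [y], [F_n] loses at most the jump while [H] gains
    strictly more. *)
Lemma continuous_part_incr x y : 0 < x <= 1 -> 0 < y <= 1 -> x < y ->
  continuous_part x < continuous_part y.
Proof.
move=> x01 y01 xy; have [K xyK] := straddleP x01 y01 xy.
have /andP[h _] := jump_part_gap x01 y01 xyK; have [px py] := xyK.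
have /andP[hy _] := F_n_bracketed K.+1 y01; have /andP[_ hx] := F_n_bracketed K.+1 x01.
move: hx hy; rewrite px py /continuous_part; move: h; rewrite /jump; lra.
Qed.

Lemma continuous_part_modulus : exists C : R, forall x y J,
  0 < x <= 1 -> 0 < y <= 1 -> x < y -> y - x < (2 ^+ J)^-1 ->
  continuous_part y - continuous_part x <= C / 2 ^+ J.
Proof.
have [A A0 hA] := top_moment_width R n.
have [B B0 hB] := mass_upper R n_gt0.
exists (2 * (A + B)); apply: (@bracketed_modulus _ _ (moment0 \+ jump_lo)
    (top_moment R n \+ jump_hi)).
- exact: nestedD moment_nested jump_nested.
- exact: bracketedD F_n_bracketed jump_part_bracketed.
(* The gap left by [H] equals the overlap of the bounds of [F_n], so the bounds of the sum touch. *)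
- move=> w; have := jump_gap w; rewrite /jump => h.
  change (moment R n (true :: w) 0 + jump_lo (true :: w) <=
    top_moment R n (false :: w) + jump_hi (false :: w)); lra.
- move=> w; rewrite /= /jump_hi.
  rewrite (_ : _ - _ = (top_moment R n w - moment R n w 0) + mass R n w); last by ring.
  rewrite mulrDl lerD// (le_trans (hB w))// ler_wpM2l ?(ltW B0)//.
  by rewrite lef_pV2 ?posrE ?exprn_gt0// lerXn2r ?nnegrE// ler_nat.
Qed.

End decomposition.

(** * Bounded variation, continuity and discontinuity *)

Lemma expn_vanish (R : realType) (m : nat) (C e : R) : (1 < m)%N -> 0 < e ->
  exists K : nat, C / m%:R ^+ K <= e.
Proof.
move=> m1 e0; have C0 : 0 < `|C| + 1 by rewrite ltr_wpDl.
have [K hK] := exp2_small (divr_gt0 e0 C0); exists K.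
have mK : 0 < m%:R ^+ K :> R by rewrite exprn_gt0// ltr0n ltnW.
rewrite (@le_trans _ _ ((`|C| + 1) / m%:R ^+ K))//.
  by rewrite ler_wpM2r ?invr_ge0 ?(ltW mK)// (le_trans (ler_norm C))// lerDl.
rewrite mulrC -ler_pdivlMr// (le_trans _ (ltW hK))// lef_pV2 ?posrE ?mK ?exprn_gt0//.
by rewrite lerXn2r ?nnegrE// ler_nat.
Qed.

(** Each increment of [f] is at most that of [g + h] in absolute value, and the latter telescope
    along the partition. *)
Lemma bounded_variation_diff (R : realType) (A : set R) (f g h : R -> R) (B : R) :
  (forall x, A x -> f x = g x - h x) ->
  (forall x y, A x -> A y -> x < y -> g x <= g y /\ h x <= h y) ->
  (forall x y, A x -> A y -> g x + h x - (g y + h y) <= B) ->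
  bounded_variation_on A f.
Proof.
move=> fE mono hB; exists B => a s pas sA.
pose P i := g (nth (last a s) (a :: s) i) + h (nth (last a s) (a :: s) i).
have Anth i : (i <= size s)%N -> A (nth (last a s) (a :: s) i).
  by move=> si; apply: sA; rewrite mem_nth.
rewrite /variation (@le_trans _ _ (\sum_(0 <= i < size s) (P i.+1 - P i)))//; last first.
  by rewrite telescope_sumr//; apply: hB; exact: Anth.
rewrite big_nat [leRHS]big_nat; apply: ler_sum => i /andP[_ si].
have := Anth i.+1 si; have := Anth i (ltnW si).
rewrite /P /=; set y := nth _ s i; set x := nth _ (a :: s) i => Ax Ay.
have xy : x < y by apply: (pathP (last a s) pas).
have [gxy hxy] := mono _ _ Ax Ay xy; rewrite !fE//.
by rewrite ler_norml; apply/andP; split; lra.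
Qed.

Section regularity.
Variables (R : realType) (n : nat).
Hypothesis n_gt0 : (0 < n)%N.
Implicit Types (x y : R) (w : seq bool) (k : nat -> nat).

Local Notation H := (@jump_part R n).
Local Notation G := (@continuous_part R n).

Lemma unitP x : `]0, 1]%classic x <-> 0 < x <= 1.
Proof. by rewrite /= in_itv. Qed.

Lemma F_n_bounded_variation : bounded_variation_on `]0, 1]%classic (@F_n R n).
Proof.
apply: (@bounded_variation_diff _ _ _ G H (G 1 + H 1)).
- by move=> x _; rewrite /continuous_part addrK.
- move=> x y /unitP x01 /unitP y01 xy.
  by split; apply/ltW; [exact: continuous_part_incr|exact: jump_part_incr].
- move=> x y /unitP x01 /unitP y01.
  have H0 z : 0 < z <= 1 -> 0 <= H z.
    move=> z01; have /andP[h _] := jump_part_bracketed n_gt0 0 z01.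
    by rewrite (le_trans _ h).
  have G0 z : 0 < z <= 1 -> 0 <= G z.
    by move=> z01; rewrite addr_ge0 ?H0// ltW// (lt_trans ltr01)// F_n_gt1.
  have one : 0 < (1 : R) <= 1 by rewrite ltr01 /=.
  have [GH1 GH2] : G x <= G 1 /\ H x <= H 1.
    have /andP[_] := x01; rewrite le_eqVlt => /predU1P[->|x1]; first by split.
    split; apply/ltW; first exact: (continuous_part_incr n_gt0 x01 one).
    exact: (jump_part_incr n_gt0 x01 one).
  have := G0 _ y01; have := H0 _ y01; lra.
Qed.

Lemma continuous_part_continuous : {within `]0, 1], continuous G}.
Proof.
apply/subspace_continuousP => x /unitP x01; apply/cvgrPdist_le => e e0.
have [C hC] := continuous_part_modulus R n_gt0.
have [J hJ] := expn_vanish C (ltnSn 1) e0.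
rewrite near_withinE; apply/nbhs_ballP; exists (2 ^+ J)^-1 => /=.
  by rewrite invr_gt0 exprn_gt0.
move=> y; rewrite /ball/= => xy /unitP y01.
have [lt|lt|->] := ltgtP x y; last by rewrite subrr normr0 ltW.
- rewrite distrC gtr0_norm ?subr_gt0 ?continuous_part_incr//.
  by rewrite (le_trans (hC _ _ J _ _ _ _))// (le_lt_trans _ xy)// distrC ler_norm.
- rewrite gtr0_norm ?subr_gt0 ?continuous_part_incr//.
  by rewrite (le_trans (hC _ _ J _ _ _ _))// (le_lt_trans _ xy)// ler_norm.
Qed.

Lemma prefix_suffix x v u : prefix x (size (u ++ v)) = u ++ v -> prefix x (size v) = v.
Proof. by elim: u => //= b u IH []. Qed.

(** A block starts with a one exactly when it has length one. *)
Lemma digit_tau k r : That k -> digit (tau R k) (size (sequence_word k r)) = (k r == 1)%N.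
Proof.
move=> k0; have := prefix_tau R r.+1 k0; rewrite sequence_wordS.
have := k0 r; case: (k r) => // -[|j] _ h.
  by case: h.
have {}h : prefix (tau R k) (size ((true :: nseq j false) ++ false :: sequence_word k r)) =
    (true :: nseq j false) ++ false :: sequence_word k r.
  have E : (true :: nseq j false) ++ false :: sequence_word k r =
      true :: nseq j.+1 false ++ sequence_word k r.
    by rewrite /=; congr cons; elim: j {h} => //= j ->.
  by rewrite E.
by have := prefix_suffix h => -[].
Qed.

Lemma hi_prefix_lt x K i : (K <= i)%N -> digit x i = false ->
  hi R (prefix x i.+1) < hi R (prefix x K).
Proof.
move=> Ki di; rewrite prefixS di (lt_le_trans (cantor_hi_false_lt _ _ _))//.
exact: (nested_hi_rprefix (lohi_nested R) (digit x)).
Qed.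

(** The digits of [x] are ones from some [N] on, whereas [x] has a zero where it separates from a
    larger [y]. This happens before [N], so [H] rises from [x] to [y] by at least [c / (n+2)^N],
    however close [y] is. *)
Lemma jump_part_discontinuous x : (@tau R @` ThatR) x ->
  ~ (H @ within `]0, 1]%classic (nbhs x) --> H x).
Proof.
move=> [k [k0 [s [ks k1]]] <-{x}] /cvgrPdist_lt cH; set x := tau R k in cH.
have x01 : 0 < x <= 1 by exact: tau_itv.
have [c c0 hc] := jump_lower R n_gt0.
pose N := size (sequence_word k s.+1).
have dN i : (N <= i)%N -> digit x i.
  move=> /subnK <-; set r := (i - N)%N.
  have -> : (r + N)%N = size (sequence_word k (r + s.+1)).
    by elim: r => // r IH; rewrite addSn IH addSn sequence_wordS k1 // leq_addl.
  by rewrite digit_tau// k1// addnS ltnS leq_addl.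
have x1 : x < 1.
  have /andP[_ xh] := prefixP (size (sequence_word k s)).+1 x01.
  have -> : 1 = hi R (prefix x 0) by rewrite hiE /= expr0 invr1 add0r.
  rewrite (le_lt_trans xh)// hi_prefix_lt// digit_tau//.
  by apply/negbTE; rewrite gtn_eqF.
have d0 : 0 < c / n.+2%:R ^+ N by rewrite divr_gt0// exprn_gt0.
have /nbhs_ballP[r /= r0] := cH _ d0.
(* A point to the right of [x], within the radius and still at most 1. *)
pose y := x + Num.min (r / 2) (1 - x).
have m0 : 0 < Num.min (r / 2) (1 - x) by rewrite lt_min divr_gt0// subr_gt0.
have mr : Num.min (r / 2) (1 - x) < r.
  by rewrite gt_min ltr_pdivrMr// ltr_pMr// ltr1n.
have m1 : Num.min (r / 2) (1 - x) <= 1 - x by rewrite ge_min lexx orbT.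
have xy : x < y by rewrite ltrDl.
have y01 : 0 < y <= 1 by move: x01 => /andP[? ?]; rewrite /y; apply/andP; split; lra.
move=> /(_ y); rewrite /ball /= => h.
have {}h : `|H x - H y| < c / n.+2%:R ^+ N.
  apply: h; last exact/unitP.
  by rewrite distrC /y addrC addKr gtr0_norm.
have [K xyK] := straddleP x01 y01 xy.
have /andP[h1 _] := jump_part_gap n_gt0 x01 y01 xyK.
have KN : (K < N)%N.
  by rewrite ltnNge; apply/negP => /dN; case: xyK => + _; rewrite prefixS => -[->].
have : c / n.+2%:R ^+ N <= jump R n (prefix x K).
  rewrite (le_trans _ (hc _))// size_prefix ler_wpM2l ?(ltW c0)//.
  by rewrite lef_pV2 ?posrE ?exprn_gt0// ler_weXn2l ?ler1n// ltnW.
move: h; rewrite distrC => /(le_lt_trans (ler_norm _)); lra.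
Qed.

(** If [tau R k] is a right end, all later digits are ones and [k] is eventually 1; outside [ThatR]
    it is then 1 throughout, so that the right end is 1. *)
Lemma hi_prefix_tau k K : That k -> ~ ThatR k ->
  tau R k < hi R (prefix (tau R k) K) \/ hi R (prefix (tau R k) K) = 1.
Proof.
move=> k0 kR; set x := tau R k.
have x01 : 0 < x <= 1 by exact: tau_itv.
have /andP[_] := prefixP K x01; rewrite le_eqVlt => /predU1P[xE|]; last by left.
right.
have dK i : (K <= i)%N -> digit x i.
  move=> Ki; apply/negPn/negP => /negbTE di.
  have /andP[_] := prefixP i.+1 x01.
  by rewrite leNgt {2}xE hi_prefix_lt.
have kK i : (K <= i)%N -> k i = 1%N.
  move=> Ki; apply/eqP; rewrite -(digit_tau _ k0); apply: dK.
  by rewrite (leq_trans Ki)// leq_size_sequence_word.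
(* Descending induction: a last index with [k i >= 2] would place [k] in [ThatR]. *)
have k1 j : forall i, (K - j <= i)%N -> k i = 1%N.
  elim: j => [|j IH] i; first by rewrite subn0; exact: kK.
  rewrite leq_eqVlt => /predU1P[Ei|lt]; last by apply: IH; lia.
  apply/eqP/negPn/negP => ki; apply: kR; split=> //; exists i; split.
    by have := k0 i; move: ki; rewrite /That; lia.
  move=> i' ii'; apply: IH; rewrite -Ei in ii'; lia.
have k1' i : k i = 1%N by apply: (k1 K); rewrite subnn.
have sr r : size (sequence_word k r) = r.
  by elim: r => // r IH; rewrite sequence_wordS k1' /= IH.
elim: K {xE dK kK k1} => [|K IH]; first by rewrite hiE /= expr0 invr1 add0r.
rewrite prefixS -[in digit x K](sr K) digit_tau// k1' eqxx.
by have [_ _ -> _ _] := lohi_nested R (prefix x K).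
Qed.

(** Points of []0, 1]] near [x] share its first [K] digits, and on that cylinder [H] varies by at
    most the mass, of order [(n+2)^-K]. *)
Lemma jump_part_continuous x : (@tau R @` (That `\` ThatR)) x ->
  H @ within `]0, 1]%classic (nbhs x) --> H x.
Proof.
move=> [k [k0 kR] <-{x}]; set x := tau R k.
have x01 : 0 < x <= 1 by exact: tau_itv.
apply/cvgrPdist_le => e e0.
have [C C0 hC] := mass_upper R n_gt0.
have [K hK] := expn_vanish C (isT : (1 < n.+2)%N) e0.
have /andP[lx xh] := prefixP K x01.
suff : \forall y \near within `]0, 1]%classic (nbhs x), prefix y K = prefix x K.
  rewrite !near_withinE; apply: filterS => y h /[dup] /h yK /unitP y01.
  have /andP[x1 x2] := jump_part_bracketed n_gt0 K x01.
  have /andP[y1 y2] := jump_part_bracketed n_gt0 K y01.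
  rewrite yK in y1 y2; rewrite (le_trans _ hK)//.
  have := hC (prefix x K); rewrite size_prefix; apply: le_trans.
  by rewrite /jump_hi in x2 y2; rewrite ler_norml; apply/andP; split; lra.
have prefix_near y : lo R (prefix x K) < y <= hi R (prefix x K) -> prefix y K = prefix x K.
  by move=> h; rewrite -(prefix_unique h) size_prefix.
have lo_near : \forall y \near nbhs x, lo R (prefix x K) < y.
  exact: (cvgr_gt x cvg_id).
rewrite near_withinE; have [xlt|h1] := hi_prefix_tau K k0 kR.
  near=> y => _; apply: prefix_near; apply/andP; split.
    by near: y.
  by apply/ltW; near: y; exact: lt_nbhsl.
near=> y => /unitP/andP[_ y1]; apply: prefix_near; apply/andP; split.
  by near: y.
by rewrite h1.
Unshelve. all: by end_near.
Qed.

End regularity.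

(** * Comparison with the Cantor set *)

Section cantor_points.
Variables (R : realType) (m : nat).
Hypothesis m_gt2 : (2 < m)%N.
Implicit Types (b : nat -> bool) (a : nat -> nat) (x y z : R).

Let m_gt1 : (1 < m)%N. Proof. exact: ltnW. Qed.

Local Notation L := (cantor_lo R m).
Local Notation U := (cantor_hi R m).

Lemma cantor_lo_sum a N : (forall i, a i = 0%N \/ a i = m.-1) ->
  \sum_(0 <= i < N) (a i)%:R / m%:R ^+ i.+1 = L (rprefix (fun i => a i != 0%N) N).
Proof.
move=> aE; elim: N => [|N IH]; first by rewrite big_nil.
rewrite big_nat_recr//= IH size_rprefix; congr (_ + _).
case: (aE N) => ->; first by rewrite mul0r.
by rewrite -lt0n -ltnS prednK ?(ltnW m_gt1)// m_gt1.
Qed.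

Lemma value_cantor_lo_const b r : (forall i, (r <= i)%N -> ~~ b i) ->
  value L b = L (rprefix b r).
Proof.
move=> b0; have E j : L (rprefix b (j + r)) = L (rprefix b r).
  elim: j => // j IH; rewrite addSn /= (negbTE (b0 _ _)) ?leq_addl//.
  by rewrite addr0 IH.
apply: cvg_lim => //; apply/cvgrPdist_le => e e0; exists r => //= i ri.
by rewrite -(subnK ri) E subrr normr0 ltW.
Qed.

(** For [m > 2] the gap at the first differing digit is positive, so even a terminating expansion
    has only one digit sequence. *)
Lemma value_cantor_inj b b' i : b i != b' i -> value L b != value L b'.
Proof.
wlog : b b' i / exists K, [/\ rprefix b K = rprefix b' K, b K = false & b' K = true].
  move=> W bi; have [K pK] := first_difference bi.
  case E : (b K); case E' : (b' K) => // _; last by apply: (W _ _ i) => //; exists K.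
  by rewrite eq_sym; apply: (W _ _ i); [exists K|rewrite eq_sym].
move=> [K [pK b0 b1]] _.
have /andP[_] := valueP (cantor_nested R m_gt1) b K.+1.
have /andP[+ _] := valueP (cantor_nested R m_gt1) b' K.+1.
rewrite [rprefix b _]/= [rprefix b' _]/= b0 b1 pK => h1 h2.
rewrite lt_eqF// (le_lt_trans h2)// (lt_le_trans _ h1)//.
rewrite -subr_gt0 cantor_gap// divr_gt0// ?ltr0n ?subn_gt0//.
by rewrite exprn_gt0// ltr0n (ltnW m_gt1).
Qed.

Definition cantor_point x : R := value L (digit x).

Lemma cantor_point_bracketed : bracketed cantor_point L U.
Proof. by move=> x K _; exact: valueP (cantor_nested R m_gt1) _ _. Qed.

Lemma cantor_point_mem x : 0 < x <= 1 ->
  (@cantor_set R m `\` @cantor_set_b R m) (cantor_point x).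
Proof.
move=> x01; split.
  split.
    have := cantor_point_bracketed 0 x01.
    by rewrite /cantor_hi /= add0r expr0 invr1.
  pose a i := if digit x i then m.-1 else 0%N.
  have aE i : a i = 0%N \/ a i = m.-1 by rewrite /a; case: digit; [right|left].
  exists a; split=> //.
  have -> : series (fun i => (a i)%:R / m%:R ^+ i.+1 : R) = fun K => L (rprefix (digit x) K).
    apply/funext => N; rewrite /series/= cantor_lo_sum//.
    congr L; elim: N => //= N ->; congr cons; rewrite /a; case: digit => //.
    by rewrite -lt0n -ltnS prednK ?(ltnW m_gt1).
  have [//] := limn_nondecreasing (nested_lo_rprefix (cantor_nested R m_gt1) (digit x))
    (nested_lo_hi (cantor_nested R m_gt1) (digit x) ^~ 0%N).
move=> [_ [r [a [aE]]]]; rewrite cantor_lo_sum//.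
(* The terminating expansion padded with zeros; it differs from the digits of [x] at some one beyond
   [r]. *)
pose b i := (i < r)%N && (a i != 0%N).
have -> : rprefix (fun i => a i != 0%N) r = rprefix b r.
  have : (r <= r)%N by [].
  by elim: {1 3 4}r => //= j IH jr; rewrite IH ?(ltnW jr)// /b jr.
rewrite -value_cantor_lo_const => [|i ri]; last by rewrite /b ltnNge ri.
have [i ri di] := digit_infinitely_often r x01.
move=> /eqP; apply/negP; apply: (@value_cantor_inj _ _ i).
by rewrite di /b ltnNge ri.
Qed.

Lemma cantor_point_surj z : (@cantor_set R m `\` @cantor_set_b R m) z ->
  exists2 x, 0 < x <= 1 & cantor_point x = z.
Proof.
move=> [[z01 [a [aE az]]] zb]; pose b i := a i != 0%N.
have zE : value L b = z.
  apply: cvg_lim => //; rewrite (_ : (fun K => L (rprefix b K)) =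
      series (fun i => (a i)%:R / m%:R ^+ i.+1))//.
  by apply/funext => N; rewrite /series/= cantor_lo_sum.
have bio K : exists2 i, (K <= i)%N & b i.
  apply: contrapT => h; apply: zb; split=> //; exists K, a; split=> //.
  rewrite cantor_lo_sum// -zE; apply: value_cantor_lo_const => i Ki.
  by apply/negP => bi; apply: h; exists i.
have [x x01 px] := rprefix_digit R bio; exists x => //.
by rewrite -zE /cantor_point /value; congr (limn _); apply/funext => K; rewrite -px.
Qed.

Lemma cantor_point_gap x y K : 0 < x <= 1 -> 0 < y <= 1 -> straddle x y K ->
  (m - 2)%:R / m%:R ^+ K.+1 <= cantor_point y - cantor_point x <= (m%:R ^+ K)^-1.
Proof.
move=> x01 y01 xyK.
have := bracketed_gap (cantor_nested R m_gt1) cantor_point_bracketed x01 y01 xyK.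
by rewrite cantor_gap// size_prefix /cantor_hi size_prefix [_ + _ - _]addrC addKr.
Qed.

End cantor_points.

Section bilipschitz.
Variables (R : realType) (n : nat).
Hypothesis n_gt0 : (0 < n)%N.
Implicit Types (x y : R).

Local Notation H := (@jump_part R n).
Local Notation Theta := (@cantor_point R n.+2).

Lemma jump_part_inj : {in `]0, 1]%classic &, injective H}.
Proof.
move=> x y; rewrite !inE => /unitP x01 /unitP y01 xy.
have [lt|lt|//] := ltgtP x y.
  by have := jump_part_incr n_gt0 x01 y01 lt; rewrite xy ltxx.
by have := jump_part_incr n_gt0 y01 x01 lt; rewrite xy ltxx.
Qed.

(** The bijection sends [H x] to the Cantor point with the digits of [x]. *)
Lemma jump_part_bilipschitz : bilipschitz_equiv (H @` `]0, 1]%classic)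
  (@cantor_set R n.+2 `\` @cantor_set_b R n.+2).
Proof.
have m2 : (2 < n.+2)%N by rewrite !ltnS.
pose D : set R := `]0, 1]%classic.
have HK x : 0 < x <= 1 -> pinv D H (H x) = x.
  by move=> x01; apply: pinvKV; [exact: jump_part_inj|rewrite inE; exact/unitP].
have [c c0 hc] := jump_lower R n_gt0.
have [C C0 hC] := mass_upper R n_gt0.
pose m : R := n.+2%:R.
have m0 : 0 < m by rewrite ltr0n.
have nR : 0 < n%:R :> R by rewrite ltr0n.
(* For a separation after [K] digits, [Theta] grows by between [n / m^(K+1)] and [m^-K], and [H] by
   between [c / m^K] and [C / m^K]; the constants are the ratios. *)
have lip x y : 0 < x <= 1 -> 0 < y <= 1 -> x < y ->
    n%:R / m / C * (H y - H x) <= Theta y - Theta x <= c^-1 * (H y - H x).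
  move=> x01 y01 xy; have [K xyK] := straddleP x01 y01 xy.
  have /andP[h1 h2] := jump_part_gap n_gt0 x01 y01 xyK.
  have /andP[t1 t2] := cantor_point_gap m2 x01 y01 xyK.
  have := hC (prefix x K); have := hc (prefix x K); rewrite !size_prefix => hc' hC'.
  rewrite subn2 /= exprS in t1; rewrite -/m in t1 t2 hc' hC'.
  have q0 : 0 < m ^+ K by rewrite exprn_gt0.
  apply/andP; split.
    rewrite (le_trans _ t1)// invfM mulrA -mulrA ler_wpM2l ?divr_ge0 ?(ltW m0) ?(ltW nR)//.
    by rewrite mulrC ler_pdivrMr// mulrC (le_trans h2).
  rewrite (le_trans t2)// -ler_pdivrMl ?invr_gt0// invrK.
  by rewrite (le_trans hc')// ltW.
exists (Theta \o pinv D H); split.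
  split.
  - move=> _ [x /unitP x01 <-] /=; rewrite HK//; exact: cantor_point_mem.
  - move=> h h'; rewrite !inE => -[x /unitP x01 <-] [y /unitP y01 <-] /=.
    rewrite !HK// => xy; congr H.
    have [lt|lt|//] := ltgtP x y.
      have /andP[h1 _] := lip _ _ x01 y01 lt; move: h1; rewrite xy subrr leNgt.
      by rewrite mulr_gt0 ?divr_gt0// subr_gt0 jump_part_incr.
    have /andP[h1 _] := lip _ _ y01 x01 lt; move: h1; rewrite xy subrr leNgt.
    by rewrite mulr_gt0 ?divr_gt0// subr_gt0 jump_part_incr.
  - move=> z /(cantor_point_surj m2)[x x01 <-]; exists (H x).
      by exists x => //; exact/unitP.
    by rewrite /= HK.
exists (n%:R / m / C), c^-1; split; rewrite ?divr_gt0 ?invr_gt0//.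
move=> _ _ [x /unitP x01 <-] [y /unitP y01 <-]; rewrite /= !HK//.
wlog xy : x y x01 y01 / x < y.
  move=> W; have [lt|lt|->] := ltgtP x y; first exact: W.
    by rewrite distrC (distrC (Theta x)); exact: W.
  by rewrite !subrr normr0 !mulr0 lexx.
rewrite distrC (distrC (Theta x)) [`|H y - H x|]gtr0_norm ?subr_gt0 ?jump_part_incr//.
have /andP[h1 h2] := lip _ _ x01 y01 xy.
rewrite ger0_norm ?h1//; rewrite (le_trans _ h1)// mulr_ge0 ?divr_ge0 ?(ltW C0) ?(ltW m0)//.
by rewrite subr_ge0 ltW// jump_part_incr.
Qed.

End bilipschitz.

(** * Hausdorff dimension *)

Section hausdorff_facts.
Variable R : realType.
Implicit Types (U A : set R) (s d e : R).

Lemma diameter_le U d : (forall x y, U x -> U y -> `|x - y| <= d) ->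
  (diameter U <= d%:E)%E.
Proof.
by move=> h; apply: ge_ereal_sup => _ [x Ux [y Uy <-]]; rewrite lee_fin h.
Qed.

Lemma le_diameter U x y : U x -> U y -> (`|x - y|%:E <= diameter U)%E.
Proof. by move=> Ux Uy; apply: ereal_sup_ubound; exists x => //; exists y. Qed.

Lemma hausdorff_gauge_ge0 s U : (0 <= hausdorff_gauge s U)%E.
Proof. by rewrite /hausdorff_gauge; case: ifP => // _; exact: poweR_ge0. Qed.

Lemma hausdorff_gauge_le s U d : 0 <= s -> 0 <= d -> (diameter U <= d%:E)%E ->
  (hausdorff_gauge s U <= (d `^ s)%:E)%E.
Proof.
move=> s0 d0 Ud; rewrite /hausdorff_gauge; case: ifPn => [_|/set0P[x Ux]].
  by rewrite lee_fin powR_ge0.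
have U0 : (0 <= diameter U)%E by have := le_diameter Ux Ux; rewrite subrr normr0.
rewrite -poweR_EFin gt0_ler_poweR// in_itv/= ?leey ?andbT//.
Qed.

Lemma hausdorff_pre_ge0 s d A : (0 <= hausdorff_pre s d A)%E.
Proof.
apply: le_ereal_inf_tmp => _ [U _ <-]; apply: nneseries_ge0 => i _ _.
exact: hausdorff_gauge_ge0.
Qed.

Lemma hausdorff_measure_eq0 s A :
  (forall d e, 0 < d -> 0 < e -> (hausdorff_pre s d A <= e%:E)%E) ->
  hausdorff_measure s A = 0%E.
Proof.
move=> h; apply/eqP; rewrite eq_le; apply/andP; split.
  apply: ge_ereal_sup => _ [d /= d0 <-]; apply/lee_addgt0Pr => e e0.
  by rewrite add0e h.
apply: (@le_trans _ _ (hausdorff_pre s 1 A)); first exact: hausdorff_pre_ge0.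
by apply: ereal_sup_ubound; exists 1 => //=; exact: ltr01.
Qed.

Lemma powR_invX (x s : R) K : 0 <= x -> (x ^+ K)^-1 `^ s = ((x `^ s) ^+ K)^-1.
Proof.
move=> x0; rewrite -(powR_mulrn K x0) -powRN powRAC powRN powR_mulrn//.
exact: powR_ge0.
Qed.

End hausdorff_facts.

(** Numbers the words of each length, so that the cylinders of one level form a cover indexed by
    [nat]. *)
Fixpoint word_index (w : seq bool) : nat :=
  if w is b :: w' then (word_index w').*2 + b else 0%N.

Lemma word_index_lt w : (word_index w < 2 ^ size w)%N.
Proof.
elim: w => //= b w IH; rewrite expnS mul2n -(leq_double (word_index w).+1) in IH *.
by case: b; lia.
Qed.

Lemma word_index_inj w w' : size w = size w' -> word_index w = word_index w' -> w = w'.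
Proof.
elim: w w' => [|b w IH] [|b' w'] //= [sw] E.
have bE : b = b' by move/(congr1 odd): E; rewrite !oddD !odd_double; case: b b' => -[].
by rewrite bE (IH w')//; move: E; rewrite bE => /addIn/double_inj.
Qed.

Section dimension.
Variables (R : realType) (m : nat) (h : R -> R) (c C : R).
Hypotheses (m_gt1 : (1 < m)%N) (c_gt0 : 0 < c) (C_gt0 : 0 < C).
Hypothesis h_lower : forall x y K, 0 < x <= 1 -> 0 < y <= 1 -> straddle x y K ->
  c / m%:R ^+ K <= `|h x - h y|.
Hypothesis h_upper : forall x y K, 0 < x <= 1 -> 0 < y <= 1 ->
  prefix x K = prefix y K -> `|h x - h y| <= C / m%:R ^+ K.

Local Notation s0 := (ln 2 / ln m%:R : R).
Local Notation A := (h @` `]0, 1]%classic).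

Let m_gt0 : 0 < m%:R :> R. Proof. by rewrite ltr0n (ltnW m_gt1). Qed.
Let lnm_gt0 : 0 < ln m%:R :> R. Proof. by rewrite ln_gt0// ltr1n. Qed.
Let s0_gt0 : 0 < s0. Proof. by rewrite divr_gt0// ln_gt0// ltr1n. Qed.

Let powR_s0 : m%:R `^ s0 = 2 :> R.
Proof.
by rewrite /powR gt_eqF// divfK ?gt_eqF// lnK ?posrE.
Qed.

Let powR_gt2 s : s0 < s -> 2 < m%:R `^ s :> R.
Proof.
move=> s0s; rewrite -powR_s0 /powR gt_eqF// ltr_expR ltr_pM2r//.
Qed.

(** The [2^K] cylinders of level [K] have images of diameter at most [C / m^K]; their gauges add up
    to at most [C^s (2 / m^s)^K], which tends to 0 since [m^s > 2]. *)
Lemma hausdorff_measure_image0 s : s0 < s -> hausdorff_measure s A = 0%E.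
Proof.
move=> s0s; have s_ge0 : 0 <= s by rewrite ltW// (lt_trans s0_gt0).
apply: hausdorff_measure_eq0 => d e d0 e0.
pose cyl K i := h @` [set x | 0 < x <= 1 /\ word_index (prefix x K) = i].
have cyl_diam K i : (diameter (cyl K i) <= (C / m%:R ^+ K)%:E)%E.
  apply: diameter_le => _ _ [x [x01 xi] <-] [y [y01 yi] <-].
  by apply: h_upper => //; apply: word_index_inj; rewrite ?size_prefix// xi.
pose t := 2 / m%:R `^ s.
have t01 : 0 <= t < 1.
  rewrite divr_ge0 ?powR_ge0//= ltr_pdivrMr ?mul1r ?powR_gt2//.
  exact: powR_gt0.
have [K0 hK0] := expn_vanish C m_gt1 d0.
have [K [KK0 hK]] : exists K, (K0 <= K)%N /\ C `^ s * t ^+ K <= e.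
  have /cvgrPdist_le/(_ (e / C `^ s)) : (fun K => t ^+ K) @ \oo --> 0.
    by apply: cvg_expr; rewrite ger0_norm; case/andP: t01.
  rewrite divr_gt0 ?powR_gt0// => /(_ isT)[N _ hN].
  exists (maxn K0 N); split; first exact: leq_maxl.
  have := hN (maxn K0 N) (leq_maxr _ _).
  rewrite sub0r normrN ger0_norm ?exprn_ge0//; last by case/andP: t01.
  by rewrite ler_pdivlMr ?powR_gt0// mulrC.
apply: (@le_trans _ _ (\sum_(0 <= i <oo) hausdorff_gauge s (cyl K i))%E).
  apply: ereal_inf_lbound; exists (cyl K) => //; split.
    move=> _ [x /unitP x01 <-]; exists (word_index (prefix x K)) => //.
    by exists x.
  move=> i; rewrite (le_trans (cyl_diam K i))// lee_fin (le_trans _ hK0)//.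
  rewrite ler_wpM2l ?(ltW C_gt0)// lef_pV2 ?posrE ?exprn_gt0//.
  by rewrite ler_weXn2l// ler1n (ltnW m_gt1).
pose q : R := C `^ s / (m%:R `^ s) ^+ K.
have q0 : 0 <= q by rewrite divr_ge0 ?powR_ge0// exprn_ge0 ?powR_ge0.
have gq i : (hausdorff_gauge s (cyl K i) <= (if (i < 2 ^ K)%N then q else 0)%:E)%E.
  case: ifPn => iK.
    rewrite (le_trans (hausdorff_gauge_le s_ge0 _ (cyl_diam K i)))//.
      by rewrite divr_ge0 ?(ltW C_gt0)// exprn_ge0// ltW.
    by rewrite powRM ?(ltW C_gt0) ?invr_ge0 ?exprn_ge0 ?(ltW m_gt0)// powR_invX// ltW.
  (* Indices from [2 ^ K] on number no word of length [K], so these pieces are empty. *)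
  rewrite /hausdorff_gauge; case: ifPn => // /set0P[_ [x [x01 xi] _]].
  by move: iK; rewrite -xi -[K in (2 ^ K)%N](size_prefix x) word_index_lt.
apply: lime_le; first by apply: is_cvg_nneseries => i _ _; exact: hausdorff_gauge_ge0.
apply: nearW => N.
apply: (@le_trans _ _ (\sum_(0 <= i < N) (if (i < 2 ^ K)%N then q else 0)%:E)%E).
  by apply: lee_sum => i _; exact: gq.
rewrite sumEFin lee_fin (le_trans _ hK)//.
apply: (@le_trans _ _ (\sum_(0 <= i < 2 ^ K + N) (if (i < 2 ^ K)%N then q else 0))).
  rewrite [leRHS](big_cat_nat (n := N)) ?leq_addl//= lerDl sumr_ge0// => i _.
  by case: ifP.
rewrite (big_cat_nat (n := 2 ^ K)) ?leq_addr//=.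
rewrite [X in _ + X]big_nat [X in _ + X]big1 ?addr0; last first.
  by move=> i /andP[Ki _]; rewrite ltnNge Ki.
rewrite (eq_big_nat _ _ (F2 := fun=> q)) => [|i /andP[_ ->]//].
rewrite sumr_const_nat subn0 /q /t -[_ *+ (2 ^ K)]mulr_natr natrX exprMn exprVn.
by rewrite -mulrA [_^-1 * _]mulrC.
Qed.

(** The preimage of each [U i] lies in an interval of length at most [B] times the gauge. These
    intervals cover []0, 1]], so countable subadditivity of Lebesgue measure bounds the sum of the
    gauges below by [1 / B]. *)
Lemma image_cover_bound s (U : nat -> set R) : 0 <= s <= s0 ->
  A `<=` \bigcup_i U i -> (forall i, (diameter (U i) <= 1%:E)%E) ->
  ((c `^ s0 / 2)%:E <= \sum_(0 <= i <oo) hausdorff_gauge s (U i))%E.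
Proof.
move=> /andP[s_ge0 ss0] AU U1.
pose B := 2 / c `^ s0.
have cs0 : 0 < c `^ s0 by exact: powR_gt0.
have B0 : 0 < B by rewrite divr_gt0.
have interval i : exists I : set R, [/\ measurable I,
    forall x, 0 < x <= 1 -> U i (h x) -> I x &
    (lebesgue_measure I <= B%:E * hausdorff_gauge s (U i))%E].
  have [[x0 [x01 Ux]]|none] := pselect (exists x, 0 < x <= 1 /\ U i (h x)); last first.
    exists set0; split=> //; first by move=> x x01 Ux; apply: none; exists x.
    by rewrite measure0 mule_ge0 ?hausdorff_gauge_ge0// lee_fin ltW.
  have d0 : (0 <= diameter (U i))%E by have := le_diameter Ux Ux; rewrite subrr normr0.
  have dfin : diameter (U i) \is a fin_num.
    by rewrite ge0_fin_numE// (le_lt_trans (U1 i))// ltry.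
  pose d := fine (diameter (U i)).
  have dE : diameter (U i) = d%:E by rewrite fineK.
  have d_ge0 : 0 <= d by rewrite -lee_fin -dE.
  have d_le1 : d <= 1 by rewrite -lee_fin -dE.
  have gE : hausdorff_gauge s (U i) = (d `^ s)%:E.
    rewrite /hausdorff_gauge ifF ?dE ?poweR_EFin//.
    by apply/negbTE/set0P; exists (h x0).
  (* If two preimages separate after [K] digits, then [c / m^K <= d]; raising to the power [s0],
     where [m^s0 = 2], gives [2^-K <= r], and the points are at most [2^-K] apart. *)
  pose r := d `^ s0 / c `^ s0.
  have r0 : 0 <= r by rewrite divr_ge0 ?powR_ge0.
  have near_x0 x y : 0 < x <= 1 -> 0 < y <= 1 -> U i (h x) -> U i (h y) -> x < y -> y - x <= r.
    move=> x'01 y01 Ux' Uy xy; have [K xyK] := straddleP x'01 y01 xy.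
    have hd : c / m%:R ^+ K <= d.
      rewrite (le_trans (h_lower x'01 y01 xyK))// -lee_fin -dE.
      exact: le_diameter.
    have : (c / m%:R ^+ K) `^ s0 <= d `^ s0.
      by rewrite ge0_ler_powR ?nnegrE ?(ltW s0_gt0)// divr_ge0 ?(ltW c_gt0)// exprn_ge0// ltW.
    rewrite powRM ?invr_ge0 ?exprn_ge0 ?(ltW c_gt0) ?(ltW m_gt0)// powR_invX ?(ltW m_gt0)//.
    rewrite powR_s0 mulrC -ler_pdivlMr// -/r; apply: le_trans.
    have /andP[_ yh] := prefixP K y01; have /andP[lx _] := prefixP K x'01.
    have pxy : prefix x K = prefix y K by case: xyK => _; rewrite prefixS => -[_ ->].
    by rewrite hiE -pxy size_prefix in yh; lra.
  exists `[x0 - r, x0 + r]%classic; split.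
  - exact: measurable_itv.
  - move=> x x'01 Ux' /=; rewrite in_itv/=.
    have [lt|lt|->] := ltgtP x x0.
    + by have := near_x0 _ _ x'01 x01 Ux' Ux lt; lra.
    + by have := near_x0 _ _ x01 x'01 Ux Ux' lt; lra.
    + by apply/andP; split; lra.
  - rewrite lebesgue_measure_itv/= gE.
    have rd : 2 * r <= B * d `^ s.
      rewrite /r /B mulrCA mulrC ler_wpM2l ?(ltW B0)//.
      (* For [0 < d <= 1] the power decreases in the exponent, and [s <= s0]; for [d = 0] the left
         side vanishes because [s0 > 0]. *)
      move: d_ge0; rewrite le_eqVlt => /predU1P[<-|dpos].
        by rewrite powR0 ?gt_eqF// powR_ge0.
      by rewrite ger_powR// dpos.
    case: ifP => _; last by rewrite -EFinM lee_fin mulr_ge0 ?powR_ge0// ltW.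
    by rewrite -EFinB -EFinM lee_fin (le_trans _ rd)//; lra.
have [I hI] := choice interval.
have cov : `]0, 1]%classic `<=` \bigcup_i I i.
  move=> x /unitP x01; have [i _ Uix] := AU (h x) (ex_intro2 _ _ x ((unitP x).2 x01) erefl).
  by exists i => //; have [_ + _] := hI i; apply.
have mI i : measurable (I i) by have [] := hI i.
have := measure_sigma_subadditive (@lebesgue_measure R) mI (measurable_itv `]0%R, 1%R]) cov.
rewrite /= lebesgue_measure_itv /= lte01 oppr0 adde0 => le1.
have {}le1 : (1 <= B%:E * \sum_(0 <= i <oo) hausdorff_gauge s (U i))%E.
  rewrite (le_trans le1)// -nneseriesZl; last by move=> i _; exact: hausdorff_gauge_ge0.
  by apply: lee_nneseries => // i _; have [_ _] := hI i.
have -> : c `^ s0 / 2 = B^-1 by rewrite invf_div.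
by rewrite -[leLHS]mule1 lee_pdivrMl.
Qed.

Lemma hausdorff_dim_image : hausdorff_dim A = s0%:E.
Proof.
apply/eqP; rewrite eq_le; apply/andP; split.
  apply/lee_addgt0Pr => e e0; rewrite -EFinD.
  apply: ereal_inf_lbound; exists (s0 + e) => //; split.
    by rewrite addr_ge0 ?(ltW s0_gt0) ?(ltW e0).
  by apply: hausdorff_measure_image0; rewrite ltrDl.
apply: le_ereal_inf_tmp => _ [s [s_ge0 sA] <-]; rewrite lee_fin leNgt; apply/negP => ss0.
have : (hausdorff_pre s 1 A <= 0)%E.
  by rewrite -sA; apply: ereal_sup_ubound; exists 1 => //=; exact: ltr01.
apply/negP; rewrite -ltNge; apply: (@lt_le_trans _ _ (c `^ s0 / 2)%:E).
  by rewrite lte_fin divr_gt0// powR_gt0.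
apply: le_ereal_inf_tmp => _ [U [AU U1] <-]; apply: image_cover_bound => //.
by rewrite s_ge0 ltW.
Qed.

End dimension.

Theorem theorem1p2 (R : realType) (n : nat) (hn : (1 <= n)%N) :
  (forall x : R, x \in `]0, 1] -> 1 < F_n n x) /\
  bounded_variation_on `]0, 1]%classic (@F_n R n) /\
  exists G H : R -> R,
    (forall x, x \in `]0, 1] -> 1 < G x /\ 1 < H x) /\
    (forall x, x \in `]0, 1] -> F_n n x = G x - H x) /\
    (* (a) *)
    ({in `]0, 1] &, {homo G : x y / x < y}} /\
     {in `]0, 1] &, {homo H : x y / x < y}}) /\
    (* (b) *)
    {within `]0, 1], continuous G} /\
    (* (c) *)
    ((forall x, (@tau R @` ThatR) x ->
        ~ (H @ within `]0, 1]%classic (nbhs x) --> H x)) /\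
     (forall x, (@tau R @` (That `\` ThatR)) x ->
        H @ within `]0, 1]%classic (nbhs x) --> H x)) /\
    (* (d) *)
    bilipschitz_equiv (H @` `]0, 1]%classic)
      (@cantor_set R n.+2 `\` @cantor_set_b R n.+2) /\
    hausdorff_dim (H @` `]0, 1]%classic) = (ln 2 / ln n.+2%:R)%:E.
Proof.
have in01 (x : R) : x \in `]0, 1] -> 0 < x <= 1 by rewrite in_itv.
have H1 x : 0 < x <= 1 -> 1 < @jump_part R n x.
  move=> x01; have /andP[h _] := jump_part_bracketed hn 0 x01.
  by rewrite (lt_le_trans _ h)// ltr1n.
split; first by move=> x /in01; exact: F_n_gt1.
split; first exact: F_n_bounded_variation.
exists (@continuous_part R n), (@jump_part R n).
split.
  move=> x /in01 x01; split; last exact: H1.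
  by have := H1 x x01; have := F_n_gt1 hn x01; rewrite /continuous_part; lra.
split; first by move=> x _; rewrite /continuous_part addrK.
split.
  by split=> x y /in01 x01 /in01 y01;
    [exact: continuous_part_incr|exact: jump_part_incr].
split; first exact: continuous_part_continuous.
split.
  by split=> x; [exact: jump_part_discontinuous|exact: jump_part_continuous].
split; first exact: jump_part_bilipschitz.
have [c c0 hc] := jump_lower R hn.
have [C C0 hC] := mass_upper R hn.
apply: (@hausdorff_dim_image R n.+2 (@jump_part R n) c C) => // x y K x01 y01.
- move=> xyK; have /andP[h _] := jump_part_gap hn x01 y01 xyK.
  rewrite distrC (le_trans _ (ler_norm _))// (le_trans _ (ltW h))//.
  by have := hc (prefix x K); rewrite size_prefix.
- move=> pxy; have := hC (prefix x K); rewrite size_prefix; apply: le_trans.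
  have /andP[x1 x2] := jump_part_bracketed hn K x01.
  have /andP[y1 y2] := jump_part_bracketed hn K y01.
  rewrite -pxy in y1 y2; rewrite /jump_hi in x2 y2.
  by rewrite ler_norml; apply/andP; split; lra.
Qed.
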